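(* Let $0\le k\le n$ be integers and define $\Lambda:\mathcal K^n_k\to \mathbf G_k(n)$ by $\Lambda(A):=q(\operatorname{Aff}(A))$, i.e. $\Lambda(A)=\operatorname{Aff}(A)-p(\operatorname{Aff}(A))$ is the linear subspace parallel to the affine hull of $A$. Then: (1) $\Lambda$ is a retraction of $\mathcal K^n_k$ onto $\mathbf G_k(n)\subset\mathcal K^n_k$. (2) For every $W\in\mathbf G_k(n)$, the set $\Lambda^{-1}(\widetilde W)$ is homeomorphic to the topological product $\widetilde W\times\mathbb R^{n-k}\times\mathcal K^k_k$. (3) The tuple $(\mathcal K^n_k,\mathbf G_k(n),\mathbb R^{n-k}\times\mathcal K^k_k,\Lambda)$ is a fiber bundle. (4) If $\Gamma:\mathcal K^n_{k,b}\to\mathbf G_k(n)$ denotes the restriction $\Lambda|_{\mathcal K^n_{k,b}}$, then for every $W\in \mathbf G_k(n)$ the set $\Gamma^{-1}(\widetilde W)$ is homeomorphic to the topological product $\widetilde W\times\mathbb R^{n-k}\times\mathcal K^k_{k,b}$, and the tuple $(\mathcal K^n_{k,b},\mathbf G_k(n),\mathbb R^{n-k}\times\mathcal K^k_{k,b},\Gamma)$ is a fiber bundle.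
   Context: $\operatorname{Aff}(A)$ is the affine hull of $A$. $\mathcal K^n$ is the set of nonempty closed convex subsets of $\mathbb R^n$; $\mathcal K^n_k$ is the set of $A\in\mathcal K^n$ of dimension $k$ (i.e. $\operatorname{Aff}(A)$ is a $k$-dimensional flat, that is, a translate of a $k$-dimensional linear subspace), and $\mathcal K^n_{k,b}$ is the set of bounded (compact) elements of $\mathcal K^n_k$. In particular $\mathcal K^k_k$ and $\mathcal K^k_{k,b}$ are the $k$-dimensional closed, respectively compact, convex subsets of $\mathbb R^k$. $\mathcal K^n_k$ carries the topology of the Attouch-Wets metric $$d_{AW}(A,B)=\sup_{j\in\mathbb N}\min\Big\{\tfrac1j,\ \sup_{\|x\|<j}|d(x,A)-d(x,B)|\Big\},$$ where $d(x,A)=\inf_{a\in A}\|x-a\|$ and $\mathbb N=\{1,2,\dots\}$; $\mathcal K^n_{k,b}$ carries the topology of the Hausdorff metric $d_H(A,B)=\sup_{x}|d(x,A)-d(x,B)|$ (which on bounded convex sets coincides with the Attouch-Wets topology). $\mathbf G_k(n)$ is the set of $k$-dimensional linear subspaces of $\mathbb R^n$, a subset of $\mathcal K^n_k$, with the subspace topology. For a closed convex set $A$, $p(A)$ denotes the point of $A$ nearest to the origin; for a $k$-dimensional flat $F$, $q(F):=F-p(F)=\{x-p(F):x\in F\}\in \mathbf G_k(n)$. For $W\in\mathbf G_k(n)$, let $\pi_W$ be the orthogonal projection onto $W$ and $\widetilde W:=\{V\in\mathbf G_k(n):\pi_W(V)=W\}$. A fiber bundle is a tuple $(E,B,F,p)$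 where $E,B,F$ are topological spaces, $p:E\to B$ is a continuous surjection, and there is an open cover $\mathcal U$ of $B$ such that for every $U\in\mathcal U$ there is a homeomorphism $\varphi_U:U\times F\to p^{-1}(U)$ with $p(\varphi_U(b,t))=b$ for all $(b,t)\in U\times F$. A retraction is a continuous map $r:X\to A$ onto a subspace $A\subset X$ with $r|_A=\mathrm{id}_A$. *)

(* Defs.v *)
From HB Require Import structures.
From mathcomp Require Import all_boot all_order all_algebra.
From mathcomp Require Import all_classical all_reals all_analysis.
From mathcomp Require Import ring lra.

Set Implicit Arguments.
Unset Strict Implicit.
Unset Printing Implicit Defensive.

Import Order.TTheory GRing.Theory Num.Theory.
Import numFieldNormedType.Exports.

Local Open Scope classical_set_scope.
Local Open Scope ring_scope.

Section euclidean.
Context {R : realType} {n : nat}.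
Implicit Types (x y u v w : 'rV[R]_n) (A B : set 'rV[R]_n).

Definition dotv u v : R := \sum_i u 0 i * v 0 i.

(* The norm [`|x|] of the library on ['rV[R]_n] is the maximum norm; it induces
   the same topology and the same bounded sets as [enorm], but not the same
   distances. *)
Definition enorm x : R := Num.sqrt (dotv x x).

Definition dist_set x A : R := inf [set enorm (x - a) | a in A].

Lemma dotvE u v : dotv u v = (u *m v^T) 0 0.
Proof. by rewrite mxE; apply: eq_bigr => i _; rewrite mxE. Qed.

Lemma dotvC u v : dotv u v = dotv v u.
Proof. by apply: eq_bigr => i _; rewrite mulrC. Qed.

Lemma dotvDl u v w : dotv (u + v) w = dotv u w + dotv v w.
Proof. by rewrite !dotvE mulmxDl mxE. Qed.

Lemma dotvDr u v w : dotv w (u + v) = dotv w u + dotv w v.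
Proof. by rewrite dotvC dotvDl !(dotvC w). Qed.

Lemma dotvZl c u v : dotv (c *: u) v = c * dotv u v.
Proof. by rewrite !dotvE -scalemxAl mxE. Qed.

Lemma dotvZr c u v : dotv v (c *: u) = c * dotv v u.
Proof. by rewrite dotvC dotvZl dotvC. Qed.

Lemma dotvNl u v : dotv (- u) v = - dotv u v.
Proof. by rewrite -scaleN1r dotvZl mulN1r. Qed.

Lemma dotvNr u v : dotv v (- u) = - dotv v u.
Proof. by rewrite dotvC dotvNl dotvC. Qed.

Lemma dotv_ge0 x : 0 <= dotv x x.
Proof. by apply: sumr_ge0 => i _; rewrite -expr2 sqr_ge0. Qed.

Lemma dotv_eq0 x : dotv x x = 0 -> x = 0.
Proof.
move=> /eqP; rewrite psumr_eq0 => [/allP x0|i _]; last by rewrite -expr2 sqr_ge0.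
apply/rowP => i; rewrite mxE; apply/eqP.
by have := x0 i (mem_index_enum i); rewrite /= mulf_eq0 orbb.
Qed.

Lemma sqr_enorm x : enorm x ^+ 2 = dotv x x.
Proof. by rewrite sqr_sqrtr // dotv_ge0. Qed.

Lemma enorm_ge0 x : 0 <= enorm x. Proof. exact: sqrtr_ge0. Qed.

Lemma enorm0 : enorm 0 = 0.
Proof. by rewrite /enorm dotvE mul0mx mxE sqrtr0. Qed.

Lemma enormN x : enorm (- x) = enorm x.
Proof. by rewrite /enorm dotvNl dotvNr opprK. Qed.

Lemma dotv_le_enorm u v : dotv u v <= enorm u * enorm v.
Proof.
have := dotv_ge0 (dotv v v *: u - dotv u v *: v).
rewrite dotvDl !dotvDr !(dotvNl, dotvNr) !(dotvZl, dotvZr) (dotvC v u).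
have [/dotv_eq0 -> _|v0 h] := eqVneq (dotv v v) 0.
  by rewrite enorm0 mulr0 dotvE trmx0 mulmx0 mxE.
have v1 : 0 < dotv v v by rewrite lt_def v0 dotv_ge0.
have {}h : 0 <= dotv v v * (dotv u u * dotv v v - dotv u v ^+ 2) by lra.
rewrite pmulr_rge0 // subr_ge0 in h.
apply: (le_trans (ler_norm _)).
by rewrite -sqrtr_sqr -sqrtrM ?dotv_ge0 // ler_wsqrtr.
Qed.

Lemma enormD x y : enorm (x + y) <= enorm x + enorm y.
Proof.
rewrite -(@ler_pXn2r _ 2) ?nnegrE ?addr_ge0 ?enorm_ge0 //.
rewrite sqrrD !sqr_enorm dotvDl !dotvDr (dotvC y x).
have := dotv_le_enorm x y; lra.
Qed.

Lemma coord_le_enorm x i : `|x 0 i| <= enorm x.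
Proof.
rewrite -sqrtr_sqr ler_wsqrtr // /dotv (bigD1 i) //= expr2 lerDl.
by apply: sumr_ge0 => j _; rewrite -expr2 sqr_ge0.
Qed.

Lemma enorm_le_norm x : enorm x <= Num.sqrt n%:R * `|x|.
Proof.
have -> : `|x| = Num.sqrt (`|x| ^+ 2) by rewrite sqrtr_sqr normr_id.
rewrite -sqrtrM ?ler0n // ler_wsqrtr //.
have -> : n%:R * `|x| ^+ 2 = \sum_(i < n) `|x| ^+ 2.
  by rewrite sumr_const card_ord mulr_natl.
apply: ler_sum => i _; rewrite -expr2 -[leLHS]real_normK ?num_real //.
rewrite lerXn2r ?nnegrE // [leRHS]/Num.norm /= mx_normrE.
by apply/bigmax_geP; right; exists (0, i).
Qed.

Lemma dist_set_has_inf x A : A !=set0 -> has_inf [set enorm (x - a) | a in A].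
Proof.
move=> [a Aa]; split; first by exists (enorm (x - a)), a.
by exists 0 => _ [b _ <-]; exact: enorm_ge0.
Qed.

Lemma dist_set_le x A a : A a -> dist_set x A <= enorm (x - a).
Proof.
move=> Aa; apply: ge_inf; last by exists a.
by have [] := @dist_set_has_inf x A (ex_intro _ _ Aa).
Qed.

Lemma dist_set_ge0 x A : A !=set0 -> 0 <= dist_set x A.
Proof.
move=> [a Aa]; apply: lb_le_inf; first by exists (enorm (x - a)), a.
by move=> _ [b _ <-]; exact: enorm_ge0.
Qed.

Lemma dist_set_closed x A : A !=set0 -> closed A -> dist_set x A = 0 -> A x.
Proof.
move=> A0 Acl x0; apply: Acl => N /nbhs_ballP[e /= e0 eN].
have /inf_lt[|_ [a Aa <-] ae] : inf [set enorm (x - a) | a in A] < e.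
- by rewrite -/(dist_set x A) x0.
- by case: A0 => a Aa; exists (enorm (x - a)), a.
exists a; split => //; apply: eN; split => // i j; rewrite (ord1 i) /ball /=.
by rewrite (le_lt_trans _ ae) // (le_trans _ (coord_le_enorm _ j)) // !mxE.
Qed.

Lemma dist_set_lip x y A : A !=set0 -> dist_set x A <= dist_set y A + enorm (x - y).
Proof.
move=> A0; rewrite -lerBlDr; apply: lb_le_inf.
  by case: A0 => a Aa; exists (enorm (y - a)), a.
move=> _ [a Aa <-]; rewrite lerBlDr.
rewrite (le_trans (dist_set_le x Aa)) //.
have -> : x - a = (y - a) + (x - y) by rewrite [RHS]addrC addrA subrK.
exact: enormD.
Qed.


Lemma dist_set_sub_le x y A B :
  A !=set0 -> B !=set0 ->
  `|dist_set x A - dist_set x B| <= dist_set y A + dist_set y B + enorm (x - y) *+ 2.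
Proof.
move=> A0 B0; have := dist_set_lip x y A0; have := dist_set_lip x y B0.
have := dist_set_ge0 x A0; have := dist_set_ge0 x B0.
have := dist_set_ge0 y A0; have := dist_set_ge0 y B0; have := enorm_ge0 (x - y).
rewrite ler_norml mulr2n => *; apply/andP; split; lra.
Qed.

Definition is_flat (k : nat) F :=
  exists (v : 'rV[R]_n) (V : {vspace 'rV[R]_n}),
    \dim V = k /\ F = [set v + x | x in [set` V]].

Definition is_linear (k : nat) F :=
  exists V : {vspace 'rV[R]_n}, \dim V = k /\ F = [set` V].

Definition Aff A : set 'rV[R]_n := smallest (fun F => exists k, is_flat k F) A.

(* The default value 0 of [xget] is irrelevant for nonempty closed convex sets,
   which have exactly one point of least norm; likewise for [oproj] on linear
   subspaces, by [orthogonal_decomposition]. *)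
Definition nearest0 A : 'rV[R]_n :=
  xget 0 [set a | A a /\ forall b, A b -> enorm a <= enorm b].

Definition direction F : set 'rV[R]_n := [set x - nearest0 F | x in F].

Definition oproj (L : set 'rV[R]_n) x : 'rV[R]_n :=
  xget 0 [set w | L w /\ forall u, L u -> dotv (x - w) u = 0].

Lemma orthogonal_decomposition (V : {vspace 'rV[R]_n}) x :
  exists2 w, w \in V & forall u, u \in V -> dotv (x - w) u = 0.
Proof.
pose B : 'M[R]_(\dim V, n) := \matrix_i (vbasis V)`_i.
have BV (c : 'rV_(\dim V)) : c *m B \in V.
  rewrite mulmx_sum_row; apply: memv_suml => i _; apply: memvZ.
  by rewrite rowK; apply: vbasis_mem; rewrite mem_nth // size_tuple.
have VB u : u \in V -> exists c, u = c *m B.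
  move=> /coord_vbasis uE; exists (\row_i coord (vbasis V) i u).
  by rewrite mulmx_sum_row {1}uE; apply: eq_bigr => i _; rewrite rowK mxE.
have Bfree (c : 'rV_(\dim V)) : c *m B = 0 -> c = 0.
  rewrite mulmx_sum_row => cB; apply/rowP => i; rewrite [RHS]mxE.
  have /freeP : free (vbasis V) by exact: basis_free (vbasisP V).
  move/(_ (fun i => c 0 i)); apply.
  by rewrite -[RHS]cB; apply: eq_bigr => j _; rewrite rowK.
have Gu : B *m B^T \in unitmx.
  rewrite -row_free_unit; apply: inj_row_free => c cG; apply: Bfree.
  apply: dotv_eq0; rewrite dotvE trmx_mul mulmxA -(mulmxA c) cG mul0mx.
  by rewrite mxE.
exists (x *m B^T *m invmx (B *m B^T) *m B) => [|u /VB[c ->]]; first exact: BV.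
rewrite dotvE trmx_mul mulmxA mulmxBl -(mulmxA _ B) mulmxKV // subrr.
by rewrite mul0mx mxE.
Qed.

Lemma orthogonal_le (V : {vspace 'rV[R]_n}) z v :
  v \in V -> (forall u, u \in V -> dotv z u = 0) ->
  enorm z <= enorm (z + v).
Proof.
move=> vV zV; rewrite ler_wsqrtr // dotvDl !dotvDr (dotvC v z) (zV _ vV).
by rewrite addr0 add0r lerDl dotv_ge0.
Qed.

Lemma direction_flat (k : nat) F : is_flat k F -> is_linear k (direction F).
Proof.
move=> [v [V [dV ->]]]; exists V; split => //.
have [w wV vw] := orthogonal_decomposition V v.
set F' := (X in direction X).
have F'E y : F' y <-> y - v \in V.
  split=> [[x /= xV <-]|yV]; first by rewrite addrC addKr.
  by exists (y - v) => //; rewrite addrC subrK.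
have pF : F' (nearest0 F').
  rewrite /nearest0; case: xgetP => [y -> []//|/(_ (v - w)) []]; split.
    by apply/F'E; rewrite addrC addKr memvN.
  move=> b /F'E bV; have -> : b = (v - w) + (b - v + w).
    by apply/rowP => i; rewrite !mxE; ring.
  by apply: orthogonal_le vw; rewrite memvD.
apply/seteqP; split => [_ [x /F'E xF <-]|x /= xV].
  have -> : x - nearest0 F' = (x - v) - (nearest0 F' - v).
    by rewrite opprB addrA subrK.
  by rewrite /= memvB //; exact/F'E.
exists (x + nearest0 F'); last by rewrite addrK.
by apply/F'E; rewrite -addrA memvD //; exact/F'E.
Qed.

Lemma linear_flat (k : nat) L : is_linear k L -> is_flat k L.
Proof.
move=> [V [dV ->]]; exists 0, V; split => //.
by apply/seteqP; split => [x xV|_ [x xV <-]] /=; [exists x|]; rewrite ?add0r.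
Qed.

Lemma flat_Aff (k : nat) F : is_flat k F -> Aff F = F.
Proof.
move=> Ff; apply/seteqP; split; last exact: sub_gen_smallest.
by move=> x; apply; split => //; exists k.
Qed.

Lemma linear_nonempty (k : nat) L : is_linear k L -> L !=set0.
Proof. by move=> [V [_ ->]]; exists 0; rewrite /= mem0v. Qed.

Lemma linear_convex (k : nat) L :
  is_linear k L -> convex_set (M := 'rV[R]_n) L.
Proof.
move=> [V [_ ->]] x y t; rewrite !inE /= => xV yV.
by rewrite memvD // memvZ.
Qed.

Lemma linear_closed (k : nat) L : is_linear k L -> closed L.
Proof.
move=> [V [_ ->]] x xV /=; have [w wV xw] := orthogonal_decomposition V x.
suff : enorm (x - w) <= 0.
  rewrite le_eqVlt ltNge enorm_ge0 orbF => /eqP h.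
  have /dotv_eq0/eqP : dotv (x - w) (x - w) = 0 by rewrite -sqr_enorm h expr0n.
  by rewrite subr_eq0 => /eqP ->.
apply/ler_addgt0Pr => e e0; rewrite add0r.
have d0 : 0 < e / (Num.sqrt n%:R + 1).
  by rewrite divr_gt0 // ltr_wpDl // sqrtr_ge0.
have [y [yV]] := xV _ (nbhsx_ballx x _ d0).
rewrite -ball_normE /= ltr_pdivlMr ?ltr_wpDl ?sqrtr_ge0 // => xy.
have yE : x - y = (x - w) + (w - y) by rewrite addrA subrK.
apply: (@le_trans _ _ (enorm (x - y))).
  by rewrite yE; apply: orthogonal_le xw; rewrite memvB.
rewrite (le_trans (enorm_le_norm _)) // ltW // (le_lt_trans _ xy) //.
by rewrite mulrC ler_wpM2l // lerDl.
Qed.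

End euclidean.

(* The set K^n_k; its metric is [dAW]. *)
Record ccvx (R : realType) (n k : nat) := Ccvx {
  ccvx_set :> set 'rV[R]_n;
  ccvx_nonempty : ccvx_set !=set0;
  ccvx_closed : closed ccvx_set;
  ccvx_convex : convex_set (M := 'rV[R]_n) ccvx_set;
  ccvx_dim : is_flat k (Aff ccvx_set)
}.

(* The set K^n_{k,b}; its metric is [dH]. *)
Record bccvx (R : realType) (n k : nat) := Bccvx {
  bccvx_ccvx :> ccvx R n k;
  bccvx_bounded : bounded_set (bccvx_ccvx : set 'rV[R]_n)
}.

Lemma ccvx_inj (R : realType) (n k : nat) : injective (@ccvx_set R n k).
Proof.
move=> [A A1 A2 A3 A4] [B B1 B2 B3 B4] /= AB; subst B.
by congr Ccvx; exact: Prop_irrelevance.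
Qed.

Lemma bccvx_inj (R : realType) (n k : nat) : injective (@bccvx_ccvx R n k).
Proof.
move=> [A A1] [B B1] /= AB; subst B.
by congr Bccvx; exact: Prop_irrelevance.
Qed.

HB.instance Definition _ (R : realType) (n k : nat) := gen_eqMixin (ccvx R n k).
HB.instance Definition _ (R : realType) (n k : nat) :=
  gen_choiceMixin (ccvx R n k).
HB.instance Definition _ (R : realType) (n k : nat) := gen_eqMixin (bccvx R n k).
HB.instance Definition _ (R : realType) (n k : nat) :=
  gen_choiceMixin (bccvx R n k).

Section attouch_wets.
Context {R : realType} {n : nat}.
Implicit Types A B : set 'rV[R]_n.

(* The suprema are taken in [R], where [sup] is meaningful only for nonempty
   bounded sets; these are nonempty and bounded, see [dAW_has_sup] and
   [dAWj_has_sup]. *)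
Definition dAWj (j : nat) A B : R :=
  sup [set `|dist_set x A - dist_set x B| | x in [set x | enorm x < j%:R]].

Definition dAW A B : R :=
  sup [set Num.min j%:R^-1 (dAWj j A B) | j in [set j | (0 < j)%N]].

Lemma dAWj_has_sup (j : nat) A B : (0 < j)%N -> A !=set0 -> B !=set0 ->
  has_sup [set `|dist_set x A - dist_set x B| | x in [set x | enorm x < j%:R]].
Proof.
move=> j0 A0 B0; split.
  by eexists; exists 0 => //=; rewrite enorm0 ltr0n.
exists (dist_set 0 A + dist_set 0 B + j%:R *+ 2) => _ [x /= xj <-].
rewrite (le_trans (dist_set_sub_le x 0 A0 B0)) // lerD2l lerMn2r subr0.
by rewrite (ltW xj) orbT.
Qed.

Lemma dAWj_ub (j : nat) A B x : A !=set0 -> B !=set0 -> enorm x < j%:R ->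
  `|dist_set x A - dist_set x B| <= dAWj j A B.
Proof.
move=> A0 B0 xj; have j0 : (0 < j)%N.
  by rewrite -(ltr0n R) (le_lt_trans (enorm_ge0 x)).
by apply: ub_le_sup; [case: (dAWj_has_sup j0 A0 B0)|exists x].
Qed.

Lemma dAWj_ge0 (j : nat) A B : (0 < j)%N -> A !=set0 -> B !=set0 ->
  0 <= dAWj j A B.
Proof.
move=> j0 A0 B0; apply: le_trans (@dAWj_ub j A B 0 A0 B0 _) => //.
by rewrite enorm0 ltr0n.
Qed.

Lemma dAW_has_sup A B :
  has_sup [set Num.min j%:R^-1 (dAWj j A B) | j in [set j | (0 < j)%N]].
Proof.
split; first by eexists; exists 1%N.
exists 1 => _ [j /= j0 <-]; rewrite ge_min invf_le1 ?ltr0n //.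
by rewrite ler1n j0.
Qed.

Lemma dAW_ub (j : nat) A B : (0 < j)%N ->
  Num.min j%:R^-1 (dAWj j A B) <= dAW A B.
Proof. by move=> j0; apply: ub_le_sup; [case: (dAW_has_sup A B)|exists j]. Qed.

Lemma dAWxx A : A !=set0 -> dAW A A = 0.
Proof.
move=> A0; have h (j : nat) : (0 < j)%N -> dAWj j A A = 0.
  move=> j0; apply/le_anti; rewrite dAWj_ge0 // andbT.
  apply: ge_sup; first by have [] := dAWj_has_sup j0 A0 A0.
  by move=> _ [x _ <-]; rewrite subrr normr0.
apply/le_anti/andP; split.
  apply: ge_sup; first by have [] := dAW_has_sup A A.
  by move=> _ [j /= j0 <-]; rewrite h // ge_min lexx orbT.
by apply: le_trans (dAW_ub A A (ltn0Sn 0)); rewrite h // le_min invr_ge0 ler0n /=.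
Qed.

Lemma dAWC A B : dAW A B = dAW B A.
Proof.
congr sup; apply: eq_imagel => j _; congr Num.min.
by congr sup; apply: eq_imagel => x _; rewrite distrC.
Qed.

Lemma dAW_eq0 A B : A !=set0 -> B !=set0 -> closed A -> closed B ->
  dAW A B = 0 -> A = B.
Proof.
move=> A0 B0 Acl Bcl AB0.
have AB x : dist_set x A = dist_set x B.
  have [j xj] : exists j : nat, enorm x < j%:R.
    by exists (Num.truncn (enorm x)).+1; exact: truncnS_gt.
  have j0 : (0 < j)%N by rewrite -(ltr0n R) (le_lt_trans (enorm_ge0 x)).
  apply/eqP; rewrite -subr_eq0 -normr_le0 (le_trans (dAWj_ub A0 B0 xj)) //.
  have := dAW_ub A B j0; rewrite AB0 ge_min => /orP[|//].
  by rewrite leNgt invr_gt0 ltr0n j0.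
have h C x : C !=set0 -> C x -> dist_set x C = 0.
  move=> C0 Cx; apply/le_anti; rewrite dist_set_ge0 // andbT.
  by rewrite (le_trans (dist_set_le x Cx)) // subrr enorm0.
by apply/seteqP; split => x /(h _ _ _) => [/(_ A0)|/(_ B0)];
  [rewrite AB|rewrite -AB]; exact: dist_set_closed.
Qed.

Lemma dAW_triangle B A C : A !=set0 -> B !=set0 -> C !=set0 ->
  dAW A C <= dAW A B + dAW B C.
Proof.
move=> A0 B0 C0; apply: ge_sup; first by have [] := dAW_has_sup A C.
move=> _ [j /= j0 <-]; have h : dAWj j A C <= dAWj j A B + dAWj j B C.
  apply: ge_sup; first by have [] := dAWj_has_sup j0 A0 C0.
  move=> _ [x /= xj <-]; rewrite (le_trans (ler_distD (dist_set x B) _ _)) //.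
  by rewrite lerD // dAWj_ub.
apply: le_trans (lerD (dAW_ub A B j0) (dAW_ub B C j0)).
have := dAWj_ge0 j0 A0 B0; have := dAWj_ge0 j0 B0 C0.
have : 0 <= j%:R^-1 :> R by rewrite invr_ge0 ler0n.
by rewrite !minEle; do 3 case: ifP => ?; lra.
Qed.

(* As for [dAW], this is a supremum in [R]; the set is bounded when [A] and [B]
   are, see [dH_has_sup]. *)
Definition dH A B : R := sup (range (fun x => `|dist_set x A - dist_set x B|)).

Lemma dH_has_sup A B :
  A !=set0 -> B !=set0 -> bounded_set A -> bounded_set B ->
  has_sup (range (fun x => `|dist_set x A - dist_set x B|)).
Proof.
move=> A0 B0 /ex_strict_bound_gt0[M M0 AM] /ex_strict_bound_gt0[N N0 BN].
split; first by eexists; exists 0.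
exists (Num.sqrt n%:R * (M + N)) => _ [x _ <-].
have key C D e f : C !=set0 -> D !=set0 -> (forall y, C y -> `|y| < e) ->
    (forall y, D y -> `|y| < f) ->
    dist_set x C - dist_set x D <= Num.sqrt n%:R * (e + f).
  move=> [c Cc] D0 Ce Df; rewrite lerBlDr -lerBlDl; apply: lb_le_inf.
    by case: D0 => d Dd; eexists; exists d.
  move=> _ [d Dd <-]; rewrite lerBlDl (le_trans (dist_set_le x Cc)) //.
  have -> : x - c = (d - c) + (x - d) by rewrite [RHS]addrC addrA subrK.
  rewrite (le_trans (enormD _ _)) // lerD2r (le_trans (enorm_le_norm _)) //.
  rewrite ler_wpM2l ?sqrtr_ge0 // (le_trans (ler_normB _ _)) // addrC.
  by rewrite lerD // ltW //; [exact: Ce|exact: Df].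
rewrite ler_norml lerNl opprB; apply/andP; split; last exact: key.
by rewrite (addrC M); exact: key.
Qed.

Lemma dH_ub A B x :
  A !=set0 -> B !=set0 -> bounded_set A -> bounded_set B ->
  `|dist_set x A - dist_set x B| <= dH A B.
Proof.
by move=> A0 B0 Ab Bb; apply: ub_le_sup; [have [] := dH_has_sup A0 B0 Ab Bb|exists x].
Qed.

Lemma dHC A B : dH A B = dH B A.
Proof. by congr sup; apply: eq_imagel => x _; rewrite distrC. Qed.

Lemma dHxx A : A !=set0 -> bounded_set A -> dH A A = 0.
Proof.
move=> A0 Ab; apply/le_anti/andP; split; last first.
  by apply: le_trans (dH_ub 0 A0 A0 Ab Ab).
apply: ge_sup; first by have [] := dH_has_sup A0 A0 Ab Ab.
by move=> _ [x _ <-]; rewrite subrr normr0.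
Qed.

Lemma dAW_le_dH A B :
  A !=set0 -> B !=set0 -> bounded_set A -> bounded_set B ->
  dAW A B <= dH A B.
Proof.
move=> A0 B0 Ab Bb; apply: ge_sup; first by have [] := dAW_has_sup A B.
move=> _ [j /= j0 <-]; rewrite ge_min; apply/orP; right.
apply: ge_sup; first by have [] := dAWj_has_sup j0 A0 B0.
by move=> _ [x _ <-]; exact: dH_ub.
Qed.

Lemma dAW_ge0 A B : A !=set0 -> B !=set0 -> 0 <= dAW A B.
Proof.
move=> A0 B0; apply: le_trans (dAW_ub A B (ltn0Sn 0)).
by rewrite le_min invr_ge0 ler0n dAWj_ge0.
Qed.

Lemma dH_eq0 A B :
  A !=set0 -> B !=set0 -> closed A -> closed B ->
  bounded_set A -> bounded_set B -> dH A B = 0 -> A = B.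
Proof.
move=> A0 B0 Acl Bcl Ab Bb AB; apply: dAW_eq0 => //; apply/le_anti.
by rewrite dAW_ge0 // andbT -AB dAW_le_dH.
Qed.

Lemma dH_triangle B A C : A !=set0 -> B !=set0 -> C !=set0 ->
  bounded_set A -> bounded_set B -> bounded_set C ->
  dH A C <= dH A B + dH B C.
Proof.
move=> A0 B0 C0 Ab Bb Cb; apply: ge_sup.
  by have [] := dH_has_sup A0 C0 Ab Cb.
move=> _ [x _ <-]; rewrite (le_trans (ler_distD (dist_set x B) _ _)) //.
by rewrite lerD // dH_ub.
Qed.

End attouch_wets.

Section metrics.
Context (R : realType) (n k : nat).

Let AWxx (A : ccvx R n k) : dAW A A = 0.
Proof. exact/dAWxx/ccvx_nonempty. Qed.

Let AW_eq0 (A B : ccvx R n k) : dAW A B = 0 -> A = B.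
Proof.
move=> AB; apply: ccvx_inj; apply: dAW_eq0 AB;
  by [exact: ccvx_nonempty|exact: ccvx_closed].
Qed.

Let AWC (A B : ccvx R n k) : dAW A B = dAW B A.
Proof. exact: dAWC. Qed.

Let AW_triangle (B A C : ccvx R n k) : dAW A C <= dAW A B + dAW B C.
Proof. by apply: dAW_triangle; exact: ccvx_nonempty. Qed.

HB.instance Definition _ :=
  isMetric.Build R (ccvx R n k) AWxx AW_eq0 AWC AW_triangle.

Let Hxx (A : bccvx R n k) : dH A A = 0.
Proof. by apply: dHxx; [exact: ccvx_nonempty|exact: bccvx_bounded]. Qed.

Let H_eq0 (A B : bccvx R n k) : dH A B = 0 -> A = B.
Proof.
move=> AB; apply: bccvx_inj; apply: ccvx_inj; apply: dH_eq0 AB;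
  by [exact: ccvx_nonempty|exact: ccvx_closed|exact: bccvx_bounded].
Qed.

Let HC (A B : bccvx R n k) : dH A B = dH B A.
Proof. exact: dHC. Qed.

Let H_triangle (B A C : bccvx R n k) : dH A C <= dH A B + dH B C.
Proof.
by apply: dH_triangle; by [exact: ccvx_nonempty|exact: bccvx_bounded].
Qed.

HB.instance Definition _ :=
  isMetric.Build R (bccvx R n k) Hxx H_eq0 HC H_triangle.

End metrics.

Section topology.

Definition homeomorphism {S T : topologicalType} (f : S -> T) :=
  exists g : T -> S,
    [/\ cancel f g, cancel g f, continuous f & continuous g].

Definition homeomorphic (S T : topologicalType) :=
  exists f : S -> T, homeomorphism f.

Definition retraction {X : topologicalType} {A : set X} (r : X -> A) :=
  continuous r /\ forall a : A, r (set_val a) = a.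

Definition fiber_bundle (E B F : topologicalType) (p : E -> B) :=
  [/\ continuous p,
      forall b, exists e, p e = b &
      exists2 U : set (set B),
        (forall V, U V -> open V) /\ \bigcup_(V in U) V = setT &
        forall V, U V -> exists phi : V * F -> p @^-1` V,
          homeomorphism phi /\
          forall (b : V) (t : F), p (set_val (phi (b, t))) = set_val b].

End topology.

Section grassmannian.
Context {R : realType} {n k : nat}.

Definition linear_ccvx (L : set 'rV[R]_n) (HL : is_linear k L) : ccvx R n k :=
  Ccvx (linear_nonempty HL) (linear_closed HL) (linear_convex HL)
    (eq_ind_r (is_flat k) (linear_flat HL) (flat_Aff (linear_flat HL))).

Definition Grassmannian : set (ccvx R n k) := [set A | is_linear k A].

Definition Lambda (A : ccvx R n k) : Grassmannian :=
  exist _ (linear_ccvx (direction_flat (ccvx_dim A)))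
    (mem_set (direction_flat (ccvx_dim A))).

Definition Gamma (A : bccvx R n k) : Grassmannian := Lambda A.

Definition subspace_of (V : Grassmannian) : set 'rV[R]_n :=
  (set_val V : ccvx R n k).

Lemma LambdaE (A : ccvx R n k) :
  subspace_of (Lambda A) = direction (Aff A).
Proof. by []. Qed.

Definition tilde (W : Grassmannian) : set Grassmannian :=
  [set V | oproj (subspace_of W) @` subspace_of V = subspace_of W].

End grassmannian.

Arguments Grassmannian : clear implicits.

(* Main.v *)
Require Import Defs.
From mathcomp Require Import all_boot all_order all_algebra.
From mathcomp Require Import all_classical all_reals all_analysis.
From mathcomp Require Import ring lra.

Set Implicit Arguments.
Unset Strict Implicit.
Unset Printing Implicit Defensive.

Import Order.TTheory GRing.Theory Num.Theory.
Import numFieldNormedType.Exports.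

Local Open Scope classical_set_scope.
Local Open Scope ring_scope.

(** Fix [W] with basis [B], and complete it by a basis [C] of its orthogonal
    complement.  A subspace [V] of dimension [k] projects onto [W] exactly when
    it is the graph [{x B + x M C}] of a linear map [M], and a convex set [A]
    with [Lambda A] in [tilde W] is the graph [{x B + (x M + y) C | x in K}] of
    an affine map over its projection [K] (in coordinates).  The trivialization
    is [A <-> (Lambda A, (y, K))].

    Convergence of sets is handled on bounded regions: [A_t -> A] when, for all
    [r] and [e], eventually each point of [A_t] or [A] of norm at most [r] is
    within [e] of the other set.  This is the Attouch-Wets topology, and, for
    bounded convex sets, also the Hausdorff one.  It is preserved by the graph and
    projection maps, so the only real point is that [M] and [y] depend
    continuously on [A]: [A] contains [k + 1] affinely independent points, a
    nearby set contains [k + 1] nearby points, and [M], [y] are obtained from such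
    points by inverting a matrix.  The same argument shows that [tilde W] is
    open and that [Lambda] is continuous. *)

(** * Limits of matrix products, determinants and inverses along a filter *)

Section matrix_limits.
Context {R : realType} {T : Type} (F : set_system T) {FF : Filter F}.

Lemma cvg_mxP p q (f : T -> 'M[R]_(p, q)) (A : 'M[R]_(p, q)) :
  f @ F --> A <-> forall i j, (fun t => f t i j) @ F --> A i j.
Proof.
split=> [fA i j|fA].
  apply: (cvg_comp f (fun M : 'M[R]_(p, q) => M i j) fA).
  exact: coord_continuous.
move=> P [Q AQ QP]; apply: (@filterS _ F FF [set t | forall i j, Q i j (f t i j)]).
  by move=> t Qt; exact: QP.
apply: filter_forall => i; apply: filter_forall => j.
exact: fA (AQ i j).
Qed.

Lemma cvg_mulmx p q r (f : T -> 'M[R]_(p, q)) (g : T -> 'M[R]_(q, r))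
    (A : 'M[R]_(p, q)) (B : 'M[R]_(q, r)) :
  f @ F --> A -> g @ F --> B -> (fun t => f t *m g t) @ F --> A *m B.
Proof.
move=> /cvg_mxP fA /cvg_mxP gB; apply/cvg_mxP => i j.
rewrite mxE; under eq_fun do rewrite mxE.
apply: cvg_big => [|l _]; first exact: add_continuous.
by apply: cvgM; [exact: fA|exact: gB].
Qed.

Lemma cvg_det p (f : T -> 'M[R]_p) (A : 'M[R]_p) :
  f @ F --> A -> (fun t => \det (f t)) @ F --> \det A.
Proof.
move=> /cvg_mxP fA; apply: cvg_big => [|s _]; first exact: add_continuous.
apply: cvgM; first exact: cvg_cst.
apply: cvg_big => [|i _]; first exact: mul_continuous.
exact: fA.
Qed.

Lemma unitmx_near p (f : T -> 'M[R]_p) (A : 'M[R]_p) :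
  A \in unitmx -> f @ F --> A -> \forall t \near F, f t \in unitmx.
Proof.
rewrite unitmxE unitfE => A0 /cvg_det fA.
near=> t; rewrite unitmxE unitfE; near: t.
exact: cvgr_neq0 fA A0.
Unshelve. all: by end_near. Qed.

Lemma cvg_invmx p (f : T -> 'M[R]_p) (A : 'M[R]_p) :
  A \in unitmx -> f @ F --> A -> (fun t => invmx (f t)) @ F --> invmx A.
Proof.
move=> Au fA; rewrite /invmx Au.
(* [invmx] returns a singular matrix unchanged, so the adjugate formula holds only eventually along
   the filter. *)
apply: (@cvg_trans _ ((fun t => (\det (f t))^-1 *: \adj (f t)) @ F)).
  apply: near_eq_cvg; near=> t; rewrite ifT //.
  by near: t; exact: unitmx_near fA.
apply/cvg_mxP => i j; rewrite mxE; under eq_fun do rewrite mxE.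
apply: cvgM.
  apply: cvgV; last exact: cvg_det.
  by move: Au; rewrite unitmxE unitfE.
rewrite mxE; under eq_fun do rewrite mxE.
apply: cvgM; first exact: cvg_cst.
apply: cvg_det; move/cvg_mxP: fA => fA.
apply/cvg_mxP => i' j'; rewrite !mxE; under eq_fun do rewrite !mxE.
exact: fA.
Unshelve. all: by end_near. Qed.

End matrix_limits.

Lemma ler_norm_mulmx (R : realType) p q r (A : 'M[R]_(p, q)) (B : 'M[R]_(q, r)) :
  `|A *m B| <= q%:R * `|A| * `|B|.
Proof.
have c0 : 0 <= q%:R * `|A| * `|B| by rewrite !mulr_ge0.
rewrite [leLHS]mx_normrE; apply: bigmax_le => // -[i j] _ /=.
rewrite mxE (le_trans (ler_norm_sum _ _ _)) //.
have coord m n (M : 'M[R]_(m, n)) i' j' : `|M i' j'| <= `|M|.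
  by rewrite [leRHS]mx_normrE; apply/bigmax_geP; right; exists (i', j').
apply: (@le_trans _ _ (\sum_(l < q) `|A| * `|B|)).
  by apply: ler_sum => l _; rewrite normrM ler_pM.
by rewrite sumr_const card_ord -mulrA mulr_natl.
Qed.

(** * Convergence of sets on bounded regions and its stability under affine maps *)

Section set_limits.
Context {R : realType}.

(** Only the point of [A] is confined to the ball of radius [r]; its neighbour in [B] may lie
    outside, so points near the boundary sphere cause no trouble. *)
Definition within_nbhd p (r e : R) (A B : set 'rV[R]_p) :=
  forall a, A a -> `|a| <= r -> exists2 b, B b & `|a - b| <= e.

Definition set_cvg {T : Type} (F : set_system T) p (S : T -> set 'rV[R]_p) A :=
  forall r e : R, 0 < e ->
  \forall t \near F, within_nbhd r e A (S t) /\ within_nbhd r e (S t) A.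

Definition affine_map p q (G : 'M[R]_(p, q)) b (x : 'rV[R]_p) := x *m G + b.

(** The inverse map bounds by [s] the preimage of a point of norm at most [r], so the hypothesis at
    radius [s] applies to it. The error then splits into the change of [G], the displacement [d]
    carried by [G'], and the change of translation. *)
Lemma within_nbhd_affine p q (G G' : 'M[R]_(p, q)) b b' (H : 'M[R]_(q, p)) c
    (A A' : set 'rV[R]_p) r s d e :
  {in A, cancel (affine_map G b) (affine_map H c)} ->
  within_nbhd s d A A' ->
  q%:R * r * `|H| + `|c| <= s ->
  p%:R * s * `|G - G'| + p%:R * d * `|G'| + `|b - b'| <= e ->
  within_nbhd r e (affine_map G b @` A) (affine_map G' b' @` A').
Proof.
move=> GK AA' rs sde _ [x Ax <-] xr.
have xs : `|x| <= s.
  rewrite -(GK x) ?inE //; apply: le_trans rs; apply: le_trans (ler_normD _ _) _.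
  rewrite lerD2r; apply: le_trans (ler_norm_mulmx _ _) _.
  by rewrite ler_wpM2r // ler_wpM2l.
have [y A'y xy] := AA' _ Ax xs.
exists (affine_map G' b' y); first by exists y.
have -> : affine_map G b x - affine_map G' b' y =
    x *m (G - G') + (x - y) *m G' + (b - b').
  rewrite /affine_map mulmxBr mulmxBl opprD addrACA.
  by congr (_ + _); rewrite addrA subrK.
apply: le_trans sde; do 2 apply: le_trans (ler_normD _ _) (lerD _ _) => //.
- by rewrite (le_trans (ler_norm_mulmx _ _)) // ler_wpM2r // ler_wpM2l.
- by rewrite (le_trans (ler_norm_mulmx _ _)) // ler_wpM2r // ler_wpM2l.
Qed.

Lemma set_cvg_affine (T : Type) (F : set_system T) {FF : Filter F} p q
    (Gt : T -> 'M[R]_(p, q)) bt (Ht : T -> 'M[R]_(q, p)) ct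
    (St : T -> set 'rV[R]_p)
    (G : 'M[R]_(p, q)) (b : 'rV[R]_q) (H : 'M[R]_(q, p)) (c : 'rV[R]_p) S :
  Gt @ F --> G -> bt @ F --> b -> Ht @ F --> H -> ct @ F --> c ->
  set_cvg F St S ->
  {in S, cancel (affine_map G b) (affine_map H c)} ->
  (\forall t \near F,
     {in St t, cancel (affine_map (Gt t) (bt t)) (affine_map (Ht t) (ct t))}) ->
  set_cvg F (fun t => affine_map (Gt t) (bt t) @` St t) (affine_map G b @` S).
Proof.
move=> GtG btb HtH ctc StS GK GtK r e e0.
(* The summand 1 in [s] leaves room for the bounds given by [Ht] and [ct], which hold only in the
   limit. The choice of [d] keeps the one error term that does not tend to 0 below [e] in the
   limit. *)
pose s := q%:R * r * `|H| + `|c| + 1.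
pose d := e / (p%:R * `|G| + 1).
have pG : 0 < p%:R * `|G| + 1 by rewrite ltr_wpDl // mulr_ge0.
have d0 : 0 < d by rewrite divr_gt0.
have de : p%:R * d * `|G| < e.
  by rewrite mulrAC /d mulrA ltr_pdivrMr // mulrC ltr_pM2l // ltrDl.
have dE : p%:R * d * `|G| = 0 + p%:R * d * `|G| + 0 by rewrite addr0 add0r.
have rs : q%:R * r * `|H| + `|c| < s by rewrite ltrDl.
have rst : \forall t \near F, q%:R * r * `|Ht t| + `|ct t| <= s.
  apply: cvgr_le rs; apply: cvgD; last exact: cvg_norm.
  by apply: cvgM; [exact: cvg_cst|exact: cvg_norm].
have norm0 m n (f : T -> 'M[R]_(m, n)) (l : 'M[R]_(m, n)) : f @ F --> l ->
    (fun t => `|l - f t|) @ F --> (0 : R).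
  by move=> fl; rewrite -[0](normr0 'M[R]_(m, n)) -(subrr l);
  by apply: cvg_norm; apply: cvgB => //; exact: cvg_cst.
have sde1 : \forall t \near F,
    p%:R * s * `|G - Gt t| + p%:R * d * `|Gt t| + `|b - bt t| <= e.
  apply: cvgr_le de; rewrite [X in _ --> X]dE.
  apply: cvgD; last exact: norm0.
  apply: cvgD; last by apply: cvgM; [exact: cvg_cst|exact: cvg_norm].
  by rewrite -(mulr0 (p%:R * s)); apply: cvgM; [exact: cvg_cst|exact: norm0].
have sde2 : \forall t \near F,
    p%:R * s * `|Gt t - G| + p%:R * d * `|G| + `|bt t - b| <= e.
  apply: cvgr_le de; rewrite [X in _ --> X]dE.
  apply: cvgD; last by under eq_fun do rewrite distrC; exact: norm0.
  apply: cvgD; last exact: cvg_cst.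
  rewrite -(mulr0 (p%:R * s)); apply: cvgM; first exact: cvg_cst.
  by under eq_fun do rewrite distrC; exact: norm0.
have := StS s d d0; move=> SF; near=> t.
have [] : within_nbhd s d S (St t) /\ within_nbhd s d (St t) S.
  by near: t.
move=> SSt StS'; split.
- apply: (within_nbhd_affine GK SSt (ltW rs)).
  by near: t.
- apply: (@within_nbhd_affine _ _ _ _ _ _ (Ht t) (ct t) _ _ _ _ _ _ _ StS').
  + by near: t.
  + by near: t.
  + by near: t.
Unshelve. all: by end_near. Qed.

End set_limits.

(** * Comparison with the Attouch-Wets and Hausdorff metrics *)

Section convergence_of_sets.
Context {R : realType}.

Lemma norm_le_enorm n (x : 'rV[R]_n) : `|x| <= enorm x.
Proof.
rewrite [leLHS]mx_normrE; apply: bigmax_le => [|[i j] _ /=].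
  exact: enorm_ge0.
by rewrite ord1 coord_le_enorm.
Qed.

Lemma enormBC n (x y : 'rV[R]_n) : enorm (x - y) = enorm (y - x).
Proof. by rewrite -enormN opprB. Qed.

Lemma dist_set0 n (A : set 'rV[R]_n) a : A a -> dist_set a A = 0.
Proof.
move=> Aa; apply/le_anti; rewrite dist_set_ge0 ?andbT; last by exists a.
by rewrite (le_trans (dist_set_le a Aa)) // subrr enorm0.
Qed.

Lemma convex_setP n (A : set 'rV[R]_n) : convex_set (M := 'rV[R]_n) A <->
  forall x y (t : R), A x -> A y -> 0 <= t -> t <= 1 -> A (t *: x + (1 - t) *: y).
Proof.
split=> [cA x y t Ax Ay t0 t1|cA x y t].
  by have := cA x y (Itv01 t0 t1); rewrite !inE; exact.
by rewrite !inE => Ax Ay; apply: cA.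
Qed.

(** A minimum with [1/j] that is below [1/j] must be the other term, so the distances to [A] and [B]
    differ by less than [1/j] on the Euclidean ball of radius [j]. The factor [sqrt n] passes from
    the maximum norm to the Euclidean one. *)
Lemma within_nbhd_dAW n (A B : set 'rV[R]_n) (j : nat) r e :
  A !=set0 -> B !=set0 -> dAW A B < j%:R^-1 ->
  Num.sqrt n%:R * r < j%:R -> j%:R^-1 <= e -> within_nbhd r e A B.
Proof.
move=> A0 B0 AB rj je a Aa ar.
have aj : enorm a < j%:R.
  apply: le_lt_trans rj; apply: (le_trans (enorm_le_norm a)).
  by rewrite ler_wpM2l ?sqrtr_ge0.
have j0 : (0 < j)%N by rewrite -(ltr0n R) (le_lt_trans (enorm_ge0 a)).
have := le_lt_trans (dAW_ub A B j0) AB; rewrite gt_min ltxx /= => ABj.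
have := le_lt_trans (dAWj_ub A0 B0 aj) ABj.
rewrite (dist_set0 Aa) sub0r normrN ger0_norm ?dist_set_ge0 // => aB.
have [|_ [b Bb <-] ab] := inf_lt _ aB.
  by case: B0 => b Bb; exists (enorm (a - b)), b.
exists b => //; apply: le_trans (norm_le_enorm _) _.
exact: le_trans (ltW ab) je.
Qed.

(** The hypothesis on closer points lets the infimum over [A] be tested on points of norm at most
    [r], the ones that [within_nbhd] controls. *)
Lemma dist_set_le_within n (A B : set 'rV[R]_n) r e x :
  A !=set0 ->
  (forall a, A a -> exists a', [/\ A a', `|a'| <= r &
     enorm (x - a') <= enorm (x - a)]) ->
  within_nbhd r e A B ->
  dist_set x B <= dist_set x A + Num.sqrt n%:R * e.
Proof.
move=> [a0 Aa0] Ar AB; rewrite -lerBlDr; apply: lb_le_inf.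
  by exists (enorm (x - a0)), a0.
move=> _ [a Aa <-]; have [a' [Aa' a'r]] := Ar a Aa; apply: le_trans.
have [b Bb ab] := AB a' Aa' a'r; rewrite lerBlDr.
apply: (le_trans (dist_set_le x Bb)).
have -> : x - b = (x - a') + (a' - b) by rewrite addrA subrK.
apply: (le_trans (enormD _ _)); rewrite lerD2l.
by apply: (le_trans (enorm_le_norm _)); rewrite ler_wpM2l ?sqrtr_ge0.
Qed.

(** A point of norm above [2 |x| + |a0|] is farther from [x] than [a0] is, so [a0] can replace
    it. *)
Lemma closer_point n (A : set 'rV[R]_n) a0 r x a :
  A a0 -> enorm x *+ 2 + enorm a0 <= r -> A a ->
  exists a', [/\ A a', `|a'| <= r & enorm (x - a') <= enorm (x - a)].
Proof.
move=> Aa0 xr Aa; have x0 := enorm_ge0 x.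
have [ar|ra] := leP (enorm a) r.
  by exists a; split => //; exact: le_trans (norm_le_enorm _) ar.
exists a0; split => //.
  by apply: le_trans (norm_le_enorm _) _; rewrite mulr2n in xr; lra.
have := enormD x (- a0); rewrite enormN.
have := enormD x (a - x); rewrite addrC subrK enormBC.
by rewrite mulr2n in xr; lra.
Qed.

(** Only indices [j < 1/e] can contribute more than [e], so [x] stays in the ball of radius [1/e].
    The radius [r] makes [closer_point] applicable with [a0] in [A] and with a neighbour [b0] of it
    in [B], whose norm exceeds that of [a0] by at most [e]. *)
Lemma dAW_le_within n (A B : set 'rV[R]_n) a0 e :
  A a0 -> 0 < e ->
  let d := e / (Num.sqrt n%:R + 1) in
  let r := e^-1 *+ 2 + enorm a0 + e in
  within_nbhd r d A B -> within_nbhd r d B A -> dAW A B <= e.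
Proof.
move=> Aa0 e0 d r AB BA; have s0 := sqrtr_ge0 (n%:R : R).
have d0 : 0 <= d by rewrite divr_ge0 ?ltW // addr_ge0.
have sd : Num.sqrt n%:R * d <= e.
  rewrite /d mulrA ler_pdivrMr ?ltr_wpDl // mulrC ler_pM2l //.
  by rewrite lerDl.
have ei : 0 < e^-1 by rewrite invr_gt0.
have a0r : `|a0| <= r.
  by apply: le_trans (norm_le_enorm _) _; rewrite /r mulr2n; lra.
have [b0 Bb0 ab0] := AB a0 Aa0 a0r.
have b0r : enorm b0 <= enorm a0 + e.
  rewrite -[b0](subrKC a0); apply: le_trans (enormD _ _) _.
  rewrite lerD2l; apply: le_trans sd; apply: le_trans (enorm_le_norm _) _.
  by rewrite distrC ler_wpM2l.
apply: ge_sup; first by have [] := dAW_has_sup A B.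
move=> _ [j /= j0 <-]; rewrite ge_min.
case: leP => //= ej.
have je : j%:R < e^-1 by rewrite -[ltLHS]invrK ltf_pV2 // posrE invr_gt0 ltr0n.
apply: ge_sup; first by have [] := @dAWj_has_sup R n j A B j0
  (ex_intro _ _ Aa0) (ex_intro _ _ Bb0).
move=> _ [x /= xj <-].
have xA : enorm x *+ 2 + enorm a0 <= r by rewrite /r !mulr2n; lra.
have xB : enorm x *+ 2 + enorm b0 <= r by rewrite /r !mulr2n; lra.
have := dist_set_le_within (ex_intro _ _ Aa0) (fun a => closer_point Aa0 xA (a := a)) AB.
have := dist_set_le_within (ex_intro _ _ Bb0) (fun a => closer_point Bb0 xB (a := a)) BA.
by rewrite ler_norml => *; apply/andP; split; lra.
Qed.

(** Convexity keeps a set that is close to a bounded one on a large ball from having points far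
    away; this lets Attouch-Wets convergence imply Hausdorff convergence. *)
Lemma within_nbhd_bounded n (A B : set 'rV[R]_n) rho :
  A !=set0 -> (forall a, A a -> `|a| <= rho) ->
  convex_set (M := 'rV[R]_n) B ->
  within_nbhd (rho *+ 3 + 5) 1 A B -> within_nbhd (rho *+ 3 + 5) 1 B A ->
  forall b, B b -> `|b| <= rho *+ 3 + 5.
Proof.
move=> [a0 Aa0] Arho /convex_setP cB AB BA b Bb.
have a0r := Arho _ Aa0; have rho0 := le_trans (normr_ge0 _) a0r.
have rE : rho *+ 3 + 5 = rho + rho + rho + 5 by rewrite mulrS mulr2n addrA.
rewrite rE in AB BA *.
have [b0 Bb0 ab0] : exists2 b, B b & `|a0 - b| <= 1 by apply: AB => //; lra.
have b0r : `|b0| <= rho + 1.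
  by have := ler_normB a0 (a0 - b0); rewrite opprB subrKC; lra.
have [bb0|bb0] := leP `|b - b0| (rho + rho + 4).
  by have := ler_normD b0 (b - b0); rewrite subrKC; lra.
(* The point of the segment [b0, b] at distance 2 rho + 4 from b0 is close to
   no point of A. *)
have l0 : 0 < `|b - b0| by lra.
pose t := (rho + rho + 4) / `|b - b0|.
have t0 : 0 <= t by rewrite divr_ge0 //; lra.
have t1 : t <= 1 by rewrite ler_pdivrMr // mul1r ltW.
have Bp := cB b b0 t Bb Bb0 t0 t1; set p := (X in B X) in Bp.
have pE : p - b0 = t *: (b - b0).
  by rewrite /p scalerBl scale1r scalerBr [b0 - _]addrC addrA addrK.
have pb0 : `|p - b0| = rho + rho + 4.
  by rewrite pE normrZ ger0_norm // divfK // gt_eqF.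
have pr : `|p| <= rho + rho + rho + 5.
  by have := ler_normD b0 (p - b0); rewrite subrKC; lra.
have [a Aa pa] := BA p Bp pr.
have := ler_normD (p - a) (a - b0); rewrite addrA subrK.
have := ler_normB a b0; have := Arho a Aa; lra.
Qed.

Lemma dH_le_within n (A B : set 'rV[R]_n) r e :
  A !=set0 -> B !=set0 ->
  (forall a, A a -> `|a| <= r) -> (forall b, B b -> `|b| <= r) ->
  within_nbhd r e A B -> within_nbhd r e B A -> dH A B <= Num.sqrt n%:R * e.
Proof.
move=> A0 B0 Ar Br AB BA; apply: ge_sup; first by eexists; exists 0.
move=> _ [x _ <-].
have := dist_set_le_within (x := x) A0 _ AB.
have := dist_set_le_within (x := x) B0 _ BA.
move=> h1 h2; have {}h1 := h1 (fun b Bb => ex_intro _ b (And3 Bb (Br b Bb) (lexx _))).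
have {}h2 := h2 (fun a Aa => ex_intro _ a (And3 Aa (Ar a Aa) (lexx _))).
by rewrite ler_norml; apply/andP; split; lra.
Qed.

Section filters.
Context {T : Type} (F : set_system T) {FF : Filter F} {n k : nat}.

Lemma ccvx_cvgP (f : T -> ccvx R n k) (A : ccvx R n k) :
  f @ F --> A <-> set_cvg F (fun t => f t : set 'rV[R]_n) A.
Proof.
have A0 := ccvx_nonempty A; split=> [fA r e e0|fA].
  pose j := (Num.truncn (Num.max (Num.sqrt n%:R * r) e^-1)).+1.
  have : Num.max (Num.sqrt n%:R * r) e^-1 < j%:R by exact: truncnS_gt.
  rewrite gt_max => /andP[rj ej].
  have j0 : 0 < j%:R :> R by rewrite ltr0n.
  have je : j%:R^-1 <= e.
    by rewrite -[leRHS]invrK lef_pV2 ?posrE ?invr_gt0 // ltW.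
  have : \forall t \near F, ball A j%:R^-1 (f t).
    by apply: fA; apply: nbhsx_ballx; rewrite invr_gt0.
  apply: filterS => t ft; have ft0 := ccvx_nonempty (f t).
  split; apply: within_nbhd_dAW rj je => //.
  by rewrite dAWC.
apply/cvg_ballP => e e0; have [a0 Aa0] := A0.
have e2 : 0 < e / 2 by rewrite divr_gt0.
have d0 : 0 < e / 2 / (Num.sqrt n%:R + 1) by rewrite divr_gt0 // ltr_wpDl ?sqrtr_ge0.
have := fA ((e / 2)^-1 *+ 2 + enorm a0 + e / 2) _ d0.
apply: filterS => t [Af fA']; rewrite /ball /=.
by have := dAW_le_within Aa0 e2 Af fA'; lra.
Qed.

(** Forward, [dAW] is at most [dH]. Backward, the approximating sets eventually lie in one fixed
    ball by [within_nbhd_bounded], so truncation at radius [r] loses nothing. *)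
Lemma bccvx_cvgP (f : T -> bccvx R n k) (A : bccvx R n k) :
  f @ F --> A <-> (fun t => f t : ccvx R n k) @ F --> (A : ccvx R n k).
Proof.
have A0 := ccvx_nonempty A; have Ab := bccvx_bounded A; split=> fA.
  apply/cvg_ballP => e e0.
  have : \forall t \near F, ball A e (f t) by apply: fA; exact: nbhsx_ballx.
  apply: filterS => t; rewrite /ball /=; apply: le_lt_trans.
  by apply: dAW_le_dH => //; [exact: ccvx_nonempty|exact: bccvx_bounded].
move/ccvx_cvgP : fA => fA; apply/cvg_ballP => e e0.
have [rho rho0 Arho] := ex_strict_bound_gt0 Ab.
pose s : R := Num.sqrt n%:R + 1.
have s0 : 0 < s by rewrite ltr_wpDl ?sqrtr_ge0.
(* The cap at 1 meets the tolerance that [within_nbhd_bounded] asks for. *)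
pose d := Num.min 1 (e / 2 / s).
have d0 : 0 < d by rewrite lt_min ltr01 !divr_gt0.
pose r := rho *+ 3 + 5.
have := fA r d d0; apply: filterS => t [Af fA'].
have w1 (C D : set 'rV[R]_n) : within_nbhd r d C D -> within_nbhd r 1 C D.
  move=> CD c Cc cr; have [c' Dc' cc'] := CD c Cc cr; exists c' => //.
  by apply: (le_trans cc'); rewrite ge_min lexx.
have Ar a : (A : set 'rV[R]_n) a -> `|a| <= rho by move=> /Arho/ltW.
have ft0 := ccvx_nonempty (f t).
have fr := within_nbhd_bounded A0 Ar (@ccvx_convex _ _ _ (f t)) (w1 _ _ Af) (w1 _ _ fA').
have Ar' a : (A : set 'rV[R]_n) a -> `|a| <= r.
  by move=> /Ar ar; apply: (le_trans ar); rewrite /r mulrS mulr2n; lra.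
rewrite /ball /=; apply: le_lt_trans (dH_le_within A0 ft0 Ar' fr Af fA') _.
apply: (@le_lt_trans _ _ (s * (e / 2 / s))).
  apply: ler_pM; rewrite ?sqrtr_ge0 ?lerDl ?(ltW d0) //.
  by rewrite ge_min lexx orbT.
by rewrite mulrC divfK ?gt_eqF //; lra.
Qed.

End filters.
End convergence_of_sets.

(** * Flats, affine hulls and affinely independent points *)

Section flats.
Context {R : realType} {n : nat}.
Implicit Types A F L : set 'rV[R]_n.

(** Row-free matrices replace subspaces from here on, because limits and inverses are taken on
    matrices. *)
Lemma is_linearP k L : is_linear k L <->
  exists G : 'M[R]_(k, n), row_free G /\ L = range (mulmxr G : 'rV_k -> 'rV_n).
Proof.
split=> [[V [<- ->]]|[G [Gfree ->]]].
  pose B : 'M[R]_(\dim V, n) := \matrix_i (vbasis V)`_i; exists B; split.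
    apply: inj_row_free => c; rewrite mulmx_sum_row => cB.
    apply/rowP => i; rewrite [RHS]mxE.
    have /freeP : free (vbasis V) by exact: basis_free (vbasisP V).
    move/(_ (fun i => c 0 i)); apply.
    by rewrite -[RHS]cB; apply: eq_bigr => j _; rewrite rowK.
  apply/seteqP; split=> [x /= /coord_vbasis xE|_ [c _ <-]] /=.
    exists (\row_i coord (vbasis V) i x) => //=.
    rewrite mulmx_sum_row [RHS]xE; apply: eq_bigr => i _.
    by rewrite rowK mxE.
  rewrite mulmx_sum_row; apply: memv_suml => i _; apply: memvZ.
  by rewrite rowK; apply: vbasis_mem; rewrite mem_nth // size_tuple.
pose f : 'Hom('rV[R]_k, 'rV[R]_n) := linfun (mulmxr G).
have fE c : f c = c *m G by rewrite lfunE.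
exists (limg f); split.
  rewrite limg_dim_eq ?dimvf /= ?dim_matrix; first exact: mul1n.
  apply/eqP; rewrite -subv0; apply/subvP => c.
  rewrite memv_cap memv_ker memvf /= fE memv0 => /eqP cG.
  by apply/eqP; apply: (row_free_inj Gfree); rewrite cG mul0mx.
apply/seteqP; split=> [_ [c _ <-]|x /=] /=.
  by rewrite -fE; apply: memv_img; exact: memvf.
by case/memv_imgP => c _ ->; exists c => //=; rewrite fE.
Qed.

Lemma is_flatP k F : is_flat k F <->
  exists (G : 'M[R]_(k, n)) v, row_free G /\ F = range (affine_map G v).
Proof.
split=> [[v [V [Vk ->]]]|[G [v [Gfree ->]]]].
  have [G [Gfree VG]] : exists G : 'M[R]_(k, n),
      row_free G /\ [set` V] = range (mulmxr G : 'rV_k -> 'rV_n).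
    by apply/is_linearP; exists V.
  exists G, v; split => //; rewrite VG; apply/seteqP; split.
    by move=> _ [_ [c _ <-] <-]; exists c; rewrite // addrC.
  by move=> _ [c _ <-]; exists (c *m G); [exists c|rewrite addrC].
have /is_linearP[V [Vk VG]] : exists H : 'M[R]_(k, n),
    row_free H /\ range (mulmxr G : 'rV_k -> 'rV_n) = range (mulmxr H : 'rV_k -> 'rV_n).
  by exists G.
exists v, V; split => //; rewrite -VG; apply/seteqP; split.
  by move=> _ [c _ <-]; exists (c *m G); [exists c|rewrite addrC].
by move=> _ [_ [c _ <-] <-]; exists c; rewrite // addrC.
Qed.

Lemma range_affine_subset k l (G : 'M[R]_(k, n)) v (H : 'M[R]_(l, n)) w :
  range (affine_map G v) `<=` range (affine_map H w) -> (G <= H)%MS.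
Proof.
move=> GH; apply/row_subP => i.
have [c _ cE] : range (affine_map H w) v.
  by apply: GH; exists 0; rewrite // /affine_map mul0mx add0r.
have [d _ dE] : range (affine_map H w) (row i G + v).
  by apply: GH; exists (delta_mx 0 i); rewrite // /affine_map -rowE.
apply/submxP; exists (d - c); rewrite mulmxBl -[LHS](addrK v) -dE -cE.
by rewrite /affine_map opprD addrACA subrr addr0.
Qed.

(** These are [k + 1] affinely independent points of [A], namely [a] and the [row i D + a], whose
    flat contains [A]. *)
Definition affine_basis k A a (D : 'M[R]_(k, n)) :=
  [/\ row_free D, A a, forall i, A (row i D + a) & A `<=` range (affine_map D a)].

Lemma Aff_affine_basis k A a (D : 'M[R]_(k, n)) :
  affine_basis A a D -> Aff A = range (affine_map D a).
Proof.
move=> [Dfree Aa AD DA]; apply/seteqP; split.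
  move=> x; apply; split => //; exists k; apply/is_flatP; by exists D, a.
move=> _ [c _ <-] F [[l /is_flatP[G [v [_ ->]]]] AG].
have [c0 _ c0E] := AG _ Aa.
have /submxP[N DE] : (D <= G)%MS.
  apply/row_subP => i; have [d _ dE] := AG _ (AD i).
  apply/submxP; exists (d - c0); rewrite mulmxBl -[LHS](addrK a) -dE -c0E.
  by rewrite /affine_map opprD addrACA subrr addr0.
exists (c *m N + c0) => //.
by rewrite /affine_map mulmxDl -addrA -/(affine_map G v c0) c0E DE mulmxA.
Qed.

(** An affinely independent family in [A] of maximal size works, since a point of [A] off its flat
    could be appended. The rank bounds the size by [n]. *)
Lemma affine_basis_exists A : A !=set0 ->
  exists k a (D : 'M[R]_(k, n)), affine_basis A a D.
Proof.
move=> [a Aa].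
pose P k := `[< exists D : 'M[R]_(k, n),
  row_free D /\ forall i, A (row i D + a) >].
have exP : exists k, P k.
  by exists 0; apply/asboolP; exists 0; split; [rewrite /row_free mxrank0|case].
have leP k : P k -> (k <= n)%N.
  by move/asboolP => [D [/eqP + _]]; move=> <-; exact: rank_leq_col.
case: (ex_maxnP exP leP) => k /asboolP[D [Dfree DA]] kmax.
exists k, a, D; split => // x Ax.
have [/submxP[c cE]|xD] := boolP (x - a <= D)%MS.
  by exists c; rewrite // /affine_map -cE subrK.
suff /kmax : P (k + 1)%N by rewrite addn1 ltnn.
apply/asboolP; exists (col_mx D (x - a)); split.
  apply: inj_row_free => c; rewrite -[c]hsubmxK mul_row_col => cE.
  (* A nonzero last coefficient would express [x - a] through the rows of [D]. *)
  have c20 : rsubmx c = 0.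
    apply: contraNeq xD => c2; apply/submxP.
    exists (- (rsubmx c 0 0)^-1 *: lsubmx c).
    have c2E : rsubmx c = (rsubmx c 0 0)%:M by exact: mx11_scalar.
    have u0 : rsubmx c 0 0 != 0.
      by apply: contraNneq c2 => u0; rewrite c2E u0 raddf0.
    rewrite -scalemxAl; move: cE; rewrite {1}c2E mul_scalar_mx.
    move/eqP; rewrite addr_eq0 => /eqP ->.
    by rewrite scalerN scaleNr opprK scalerA mulVf // scale1r.
  move: cE; rewrite c20 mul0mx addr0 => c1.
  rewrite (_ : lsubmx c = 0) ?row_mx0 //.
  by apply: (row_free_inj Dfree); rewrite c1 mul0mx.
move=> i; case: (split_ordP i) => j ->.
  by rewrite rowKu.
by rewrite rowKd ord1 row_id subrK.
Qed.

Lemma affine_basis_dim k A : A !=set0 -> is_flat k (Aff A) ->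
  exists a (D : 'M[R]_(k, n)), affine_basis A a D.
Proof.
move=> /affine_basis_exists[l [a [D AD]]] /is_flatP[G [v [Gfree]]].
rewrite (Aff_affine_basis AD) => DG.
suff lk : l = k by subst l; exists a, D.
have [/eqP Dl _ _ _] := AD; move/eqP: Gfree => Gk.
rewrite -Dl -Gk; apply/eqP; rewrite eqn_leq; apply/andP; split; apply: mxrankS.
  by apply: (@range_affine_subset _ _ D a G v); rewrite DG.
by apply: (@range_affine_subset _ _ G v D a); rewrite DG.
Qed.

Lemma is_flat_affine_basis k A a (D : 'M[R]_(k, n)) :
  affine_basis A a D -> is_flat k (Aff A).
Proof.
move=> AD; rewrite (Aff_affine_basis AD); apply/is_flatP; exists D, a.
by case: AD.
Qed.

Lemma direction_affine_basis k A a (D : 'M[R]_(k, n)) :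
  affine_basis A a D -> direction (Aff A) = range (mulmxr D : 'rV_k -> 'rV_n).
Proof.
move=> AD; have /direction_flat[V [_ VE]] := is_flat_affine_basis AD.
(* Since 0 belongs to the direction, the base point [nearest0] lies on the flat; subtracting any
   point of the flat gives the same subspace. *)
have [p Ap pE] : direction (Aff A) 0 by rewrite VE /= mem0v.
rewrite (Aff_affine_basis AD) in Ap pE *.
have {}pE : p = nearest0 (range (affine_map D a)).
  by apply/eqP; rewrite -subr_eq0 pE.
rewrite /direction -pE; have [c0 _ c0E] := Ap.
apply/seteqP; split=> [_ [_ [c _ <-] <-]|_ [c _ <-]].
  exists (c - c0); rewrite //= mulmxBl -c0E /affine_map opprD addrACA subrr.
  by rewrite addr0.
exists (c *m D + p); last by rewrite /= addrK.
by exists (c + c0); rewrite // /affine_map mulmxDl -addrA -c0E.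
Qed.

End flats.

(** * Affine images under maps with a left inverse on the set *)

Section affine_images.
Context {R : realType}.

Lemma affine_map_continuous p q (G : 'M[R]_(p, q)) b : continuous (affine_map G b).
Proof.
move=> x; apply: (@cvgD _ _ _ (nbhs x) _ (mulmxr G) (cst b) (x *m G) b).
  2: exact: cvg_cst.
by apply: cvg_mulmx; [exact: cvg_id|exact: cvg_cst].
Qed.

Lemma affine_mapB p q (G : 'M[R]_(p, q)) b x y :
  affine_map G b x - affine_map G b y = (x - y) *m G.
Proof. by rewrite /affine_map opprD addrACA subrr addr0 mulmxBl. Qed.

Section image.
Context {p q k : nat} (A : ccvx R p k) (G : 'M[R]_(p, q)) (b : 'rV[R]_q).
Context (H : 'M[R]_(q, p)) (c : 'rV[R]_p).
Hypothesis GK : {in (A : set 'rV[R]_p), cancel (affine_map G b) (affine_map H c)}.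

Lemma affine_basis_image a (D : 'M[R]_(k, p)) : affine_basis A a D ->
  affine_basis (affine_map G b @` A) (affine_map G b a) (D *m G).
Proof.
move=> [Dfree Aa AD DA].
have DGE d x : affine_map (D *m G) (affine_map G b x) d =
    affine_map G b (affine_map D x d).
  by rewrite /affine_map mulmxA mulmxDl addrA.
(* Rows of [D] are differences of points of [A], and on these the linear part of the left inverse
   undoes [G]. *)
have DGH : D *m G *m H = D.
  apply/row_matrixP => i; rewrite !row_mul.
  rewrite -{1}[row i D](addrK a) -(affine_mapB G b) -(affine_mapB H c).
  by rewrite !GK ?inE // addrK.
split; [|by exists a| |].
- apply: inj_row_free => d dDG; apply: (row_free_inj Dfree).
  by rewrite mul0mx -DGH mulmxA dDG mul0mx.
- move=> i; exists (row i D + a) => //.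
  by rewrite /affine_map row_mul mulmxDl addrA.
- by move=> _ [x /DA[d _ <-] <-]; exists d.
Qed.

Lemma affine_image_nonempty : affine_map G b @` A !=set0.
Proof. by have [a Aa] := ccvx_nonempty A; exists (affine_map G b a), a. Qed.

(** The image is cut out by closed conditions: [z] belongs to it exactly when the inverse map sends
    [z] into [A] and the forward map sends the result back to [z]. *)
Lemma affine_image_closed : closed (affine_map G b @` A).
Proof.
have -> : affine_map G b @` A = (affine_map H c @^-1` A) `&`
    ((fun z => affine_map G b (affine_map H c z) - z) @^-1` [set 0]).
  apply/seteqP; split=> [_ [x Ax <-]|z [/= Az zE]].
    by split; rewrite /= GK ?inE // subrr.
  by exists (affine_map H c z) => //; apply/eqP; rewrite -subr_eq0 zE.
apply: closedI.
  apply: closed_comp; last exact: ccvx_closed.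
  by move=> x _; exact: affine_map_continuous.
apply: closed_comp; last exact: (accessible_closed_set1 (hausdorff_accessible (@norm_hausdorff _ _))).
move=> z _; apply: (@cvgB _ _ _ (nbhs z) _ (affine_map G b \o affine_map H c) id).
  2: exact: cvg_id.
by apply: continuous_comp; exact: affine_map_continuous.
Qed.

Lemma affine_image_convex : convex_set (M := 'rV[R]_q) (affine_map G b @` A).
Proof.
have /convex_setP cA := @ccvx_convex _ _ _ A.
apply/convex_setP => _ _ t [x Ax <-] [y Ay <-] t0 t1.
exists (t *: x + (1 - t) *: y); first exact: cA.
rewrite /affine_map mulmxDl -!scalemxAl !scalerDr addrACA; congr (_ + _).
by rewrite -scalerDl subrKC scale1r.
Qed.

Lemma affine_image_dim : is_flat k (Aff (affine_map G b @` A)).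
Proof.
have [a [D AD]] := affine_basis_dim (ccvx_nonempty A) (ccvx_dim A).
exact: is_flat_affine_basis (affine_basis_image AD).
Qed.

Definition affine_image : ccvx R q k :=
  Ccvx affine_image_nonempty affine_image_closed affine_image_convex
    affine_image_dim.

Lemma affine_image_bounded : bounded_set (A : set 'rV[R]_p) ->
  bounded_set (affine_image : set 'rV[R]_q).
Proof.
move=> /ex_strict_bound_gt0[M M0 AM].
exists (p%:R * M * `|G| + `|b|); split; first exact: num_real.
move=> N /ltW MN _ [x Ax <-]; apply: le_trans MN.
apply: le_trans (ler_normD _ _) _; rewrite lerD2r.
apply: le_trans (ler_norm_mulmx _ _) _.
by rewrite ler_wpM2r // ler_wpM2l // ltW // AM.
Qed.

End image.
End affine_images.

(** * Frames adapted to a subspace, and graphs over it *)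

Section frames.
Context {R : realType}.

(* [x *m B'] and [x *m C'] are the coordinates of [x] along the rows of [B] and
   of [C]. *)
Definition frame k m n (B : 'M[R]_(k, n)) (C : 'M[R]_(m, n))
    (B' : 'M[R]_(n, k)) (C' : 'M[R]_(n, m)) :=
  [/\ B *m B' = 1%:M, C *m C' = 1%:M, B *m C' = 0, C *m B' = 0 &
      B' *m B + C' *m C = 1%:M].

(** [B'] is the pseudoinverse of [B]. The rows of [C] span its kernel, the orthogonal complement of
    the row space of [B], and [C'] gives the coordinates of [1 - B' B] in [C]. The last equation
    makes [B' *m B] the orthogonal projection. *)
Lemma frame_exists k n (B : 'M[R]_(k, n)) : row_free B ->
  exists (C : 'M[R]_(n - k, n)) B' C',
    frame B C B' C' /\ (1%:M - B' *m B) *m B^T = 0.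
Proof.
move=> Bfree.
have Gu : B *m B^T \in unitmx.
  rewrite -row_free_unit; apply: inj_row_free => c cG; apply: (row_free_inj Bfree).
  rewrite mul0mx; apply: dotv_eq0.
  by rewrite dotvE trmx_mul mulmxA -(mulmxA c) cG mul0mx mxE.
pose B' := B^T *m invmx (B *m B^T).
have BB' : B *m B' = 1%:M by rewrite /B' mulmxA mulmxV.
have B'free : \rank B' = k.
  apply/eqP; rewrite eqn_leq rank_leq_col /=.
  by rewrite -{1}(mxrank1 R k) -BB' mxrankM_maxr.
have [C [Cfree CE]] : exists C : 'M[R]_(n - k, n), row_free C /\ (C :=: kermx B')%MS.
  have : \rank (kermx B') = (n - k)%N by rewrite mxrank_ker B'free.
  by move=> <-; exists (row_base (kermx B')); split;
    [exact: row_base_free|exact: eq_row_base].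
have CB' : C *m B' = 0 by apply/sub_kermxP; rewrite CE.
have /submxP[C' C'E] : (1%:M - B' *m B <= C)%MS.
  by rewrite CE; apply/sub_kermxP; rewrite mulmxBl mul1mx -mulmxA BB' mulmx1 subrr.
exists C, B', C'; split; last first.
  by rewrite mulmxBl mul1mx -mulmxA /B' mulmxKV // subrr.
split => //.
- apply: (row_free_inj Cfree); rewrite -mulmxA -C'E mulmxBr mulmxA CB' mul0mx.
  by rewrite mulmx1 subr0 mul1mx.
- apply: (row_free_inj Cfree); rewrite -mulmxA -C'E mulmxBr mulmxA BB' !mul1mx.
  by rewrite mulmx1 subrr mul0mx.
- by rewrite -C'E subrKC.
Qed.

(** This is containment in the graph, so [A] may be any part of it; slope and intercept are
    determined as soon as [A] has dimension [k]. *)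
Definition on_graph k m n (B' : 'M[R]_(n, k)) (C' : 'M[R]_(n, m)) (M : 'M[R]_(k, m))
    (y : 'rV[R]_m) (A : set 'rV[R]_n) :=
  forall a, A a -> a *m C' = a *m B' *m M + y.

Definition graph_map k m n (B : 'M[R]_(k, n)) (C : 'M[R]_(m, n)) M (y : 'rV[R]_m) :
    'rV[R]_k -> 'rV[R]_n :=
  affine_map (B + M *m C) (y *m C).

Context {k m n : nat} {B : 'M[R]_(k, n)} {C : 'M[R]_(m, n)}.
Context {B' : 'M[R]_(n, k)} {C' : 'M[R]_(n, m)}.
Hypothesis BC : frame B C B' C'.

Lemma on_graphK M y A : on_graph B' C' M y A ->
  {in A, cancel (affine_map B' 0) (graph_map B C M y)}.
Proof.
move=> MA a; rewrite inE => /MA aE; have [_ _ _ _ B'B] := BC.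
rewrite /graph_map /affine_map addr0 mulmxDr mulmxA -addrA -mulmxDl.
by rewrite -aE -!mulmxA -mulmxDr B'B mulmx1.
Qed.

Lemma graph_mapK M y : cancel (graph_map B C M y) (affine_map B' 0).
Proof.
move=> x; have [BB' _ _ CB' _] := BC.
rewrite /graph_map /affine_map addr0 !mulmxDl mulmxDr mulmxDl.
by rewrite -!mulmxA CB' BB' !mulmx0 mulmx1 !addr0.
Qed.

Lemma on_graph_image M y K : on_graph B' C' M y (graph_map B C M y @` K).
Proof.
move=> _ [x Kx <-]; have [BB' CC' BC' CB' _] := BC.
rewrite -[_ *m B'](addr0 _) -/(affine_map B' 0 _) graph_mapK.
rewrite /graph_map /affine_map !mulmxDl mulmxDr mulmxDl.
by rewrite -!mulmxA CC' BC' !mulmx0 !mulmx1 add0r.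
Qed.

Lemma on_graph_slope M y A a (D : 'M[R]_(k, n)) :
  A a -> (forall i, A (row i D + a)) -> on_graph B' C' M y A ->
  D *m C' = D *m B' *m M.
Proof.
move=> Aa AD MA; apply/row_matrixP => i.
rewrite !row_mul -[row i D](addrK a) !mulmxBl (MA _ Aa) (MA _ (AD i)).
by rewrite opprD addrACA subrr addr0 -mulmxBl.
Qed.

Lemma on_graph_intercept M y A a :
  A a -> on_graph B' C' M y A -> y = a *m C' - a *m B' *m M.
Proof. by move=> Aa MA; rewrite (MA _ Aa) addrC addKr. Qed.

(** Explicit formulas for slope and intercept give their uniqueness and, later, their continuity.
    For invertibility, a combination of rows of [D] with zero [B]-coordinates also has zero
    [C]-coordinates, these being the former times [M]. *)
Lemma on_graph_affine_basis M y A a (D : 'M[R]_(k, n)) :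
  affine_basis A a D -> on_graph B' C' M y A ->
  [/\ D *m B' \in unitmx, M = invmx (D *m B') *m (D *m C') &
      y = a *m C' - a *m B' *m M].
Proof.
move=> [Dfree Aa AD _] MA; have [_ _ _ _ B'B] := BC.
have DE := on_graph_slope Aa AD MA.
have Du : D *m B' \in unitmx.
  rewrite -row_free_unit; apply: inj_row_free => c cD.
  apply: (row_free_inj Dfree); rewrite mul0mx -[LHS]mulmx1 -B'B mulmxDr !mulmxA.
  rewrite -(mulmxA c D C') DE; move: cD; rewrite !mulmxA => ->.
  by rewrite !mul0mx addr0.
split => //; first by rewrite DE mulKmx.
exact: on_graph_intercept Aa MA.
Qed.

Lemma unit_on_graph A a (D : 'M[R]_(k, n)) :
  A `<=` range (affine_map D a) -> D *m B' \in unitmx ->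
  exists M y, on_graph B' C' M y A.
Proof.
move=> DA Du; pose M := invmx (D *m B') *m (D *m C').
exists M, (a *m C' - a *m B' *m M) => _ /DA[c _ <-].
rewrite /affine_map !mulmxDl -addrA subrKC; congr (_ + _).
by rewrite -!mulmxA (mulmxA D) /M mulKVmx.
Qed.

End frames.

(** * Continuity of slope and intercept *)

Section slope_limits.
Context {R : realType} {k m n : nat} {B : 'M[R]_(k, n)} {C : 'M[R]_(m, n)}.
Context {B' : 'M[R]_(n, k)} {C' : 'M[R]_(n, m)}.
Hypothesis BC : frame B C B' C'.
Context {T : Type} (F : set_system T) {FF : Filter F} (S : T -> set 'rV[R]_n).
Context (A : set 'rV[R]_n) (a : 'rV[R]_n) (D : 'M[R]_(k, n)).
Context (M : 'M[R]_(k, m)) (y : 'rV[R]_m).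
Hypotheses (AD : affine_basis A a D) (MA : on_graph B' C' M y A).
Hypothesis SA : set_cvg F S A.

Lemma near_affine_points (P : set ('rV[R]_n * 'M[R]_(k, n))) :
  nbhs (a, D) P -> \forall t \near F, exists a' (D' : 'M[R]_(k, n)),
    [/\ P (a', D'), S t a' & forall i, S t (row i D' + a')].
Proof.
have [_ Aa DA _] := AD.
move=> /nbhs_ballP[e /= e0 eP].
(* The radius [r] covers all [k + 1] points. A row of the new matrix is a difference of two points,
   each moved by at most [e/4], so it moves by less than [e]. *)
pose r := `|a| + \sum_i `|row i D + a|.
have e4 : 0 < e / 4 by rewrite divr_gt0.
near=> t.
have [St _] : within_nbhd r (e / 4) A (S t) /\ within_nbhd r (e / 4) (S t) A.
  by near: t; exact: SA.
have [a' Sa' aa'] : exists2 a', S t a' & `|a - a'| <= e / 4.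
  by apply: St => //; rewrite lerDl sumr_ge0.
have /choice[p pE] : forall i, exists p, S t p /\ `|row i D + a - p| <= e / 4.
  move=> i; have [|p Sp ip] := St _ (DA i); last by exists p.
  by rewrite /r (bigD1 i) //= addrCA lerDl addr_ge0 ?sumr_ge0.
exists a', (\matrix_i (p i - a')); split => //.
  apply: eP; split => /=.
    rewrite -ball_normE /=; apply: le_lt_trans aa' _; lra.
  split => // i j; rewrite -ball_normE /= mxE.
  have [_ ip] := pE i.
  have -> : D i j - (p i - a') 0 j = (row i D + a - p i - (a - a')) 0 j.
    by rewrite !mxE; ring.
  have coord (x : 'rV[R]_n) : `|x 0 j| <= `|x|.
    by rewrite [leRHS]mx_normrE; apply/bigmax_geP; right; exists (0, j).
  apply: le_lt_trans (coord _) _; apply: le_lt_trans (ler_normB _ _) _; lra.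
by move=> i; rewrite rowK subrK; have [] := pE i.
Unshelve. all: by end_near. Qed.

Let slope (D : 'M[R]_(k, n)) := invmx (D *m B') *m (D *m C').

Lemma on_graph_cvg Mt yt :
  (\forall t \near F, on_graph B' C' (Mt t) (yt t) (S t)) ->
  Mt @ F --> M /\ yt @ F --> y.
Proof.
have [Du ME yE] := on_graph_affine_basis BC AD MA => MtS.
have Dcvg q (H : 'M[R]_(n, q)) : (fun z => z.2 *m H) @ nbhs (a, D) --> D *m H.
  by apply: cvg_mulmx; [exact: cvg_snd|exact: cvg_cst].
have acvg q (H : 'M[R]_(n, q)) : (fun z => z.1 *m H) @ nbhs (a, D) --> a *m H.
  by apply: cvg_mulmx; [exact: cvg_fst|exact: cvg_cst].
have slopeX : (fun z => slope z.2) @ nbhs (a, D) --> M.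
  by rewrite ME; apply: cvg_mulmx; [apply: cvg_invmx|].
have interX : (fun z => z.1 *m C' - z.1 *m B' *m slope z.2) @ nbhs (a, D) --> y.
  rewrite yE; apply: (@cvgB _ _ _ (nbhs (a, D)) _ (fun z => z.1 *m C')).
    exact: acvg.
  by apply: cvg_mulmx; [exact: acvg|exact: slopeX].
have unitX : \forall z \near (a, D), z.2 *m B' \in unitmx by exact: unitmx_near (Dcvg _ _).
(* Every neighbourhood of [(a, D)] eventually contains a pair built from points of [S t], and on it
   the formulas return exactly [Mt t] and [yt t]. Limits of the formulas at [(a, D)] thus carry
   over. *)
have key (P : set ('M[R]_(k, m) * 'rV[R]_m)) :
    (\forall z \near (a, D), P (slope z.2, z.1 *m C' - z.1 *m B' *m slope z.2)) ->
    \forall t \near F, P (Mt t, yt t).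
  move=> PX; have : \forall z \near (a, D), z.2 *m B' \in unitmx /\
      P (slope z.2, z.1 *m C' - z.1 *m B' *m slope z.2) by exact: filterI.
  move/near_affine_points => UPX.
  near=> t.
  have tS : on_graph B' C' (Mt t) (yt t) (S t) by near: t.
  have : exists a' (D' : 'M[R]_(k, n)), [/\ D' *m B' \in unitmx /\
      P (slope D', a' *m C' - a' *m B' *m slope D'), S t a' &
      forall i, S t (row i D' + a')] by near: t; exact: UPX.
  move=> [a' [D' [[D'u PD'] Sa' SD']]].
  have D'E := on_graph_slope Sa' SD' tS.
  have MtE : Mt t = slope D' by rewrite /slope D'E mulKmx.
  by rewrite MtE; rewrite -MtE in PD' *; rewrite (on_graph_intercept Sa' tS).
split=> P PM.
  have := key (fun p => P p.1); apply; exact: slopeX.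
have := key (fun p => P p.2); apply; exact: interX.
Unshelve. all: by end_near. Qed.

Lemma near_on_graph :
  (forall t, exists a' (D' : 'M[R]_(k, n)), affine_basis (S t) a' D') ->
  \forall t \near F, exists M' y', on_graph B' C' M' y' (S t).
Proof.
have [Du _ _] := on_graph_affine_basis BC AD MA => St.
have unitX : \forall z \near (a, D), z.2 *m B' \in unitmx.
  apply: (@unitmx_near _ _ (nbhs (a, D)) _ _ (fun z => z.2 *m B') _ Du).
  by apply: cvg_mulmx; [exact: cvg_snd|exact: cvg_cst].
apply: filterS (near_affine_points unitX) => t [a' [D' [/= D'u Sa' SD']]].
(* [D'] factors through a basis matrix [D0] of [S t], so invertibility of [D' *m B'] passes to
   [D0 *m B']. *)
have [a0 [D0 [_ _ _ SD0]]] := St t.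
apply: (unit_on_graph SD0).
have [c0 _ c0E] := SD0 _ Sa'.
have /submxP[N D'E] : (D' <= D0)%MS.
  apply/row_subP => i; have [c _ cE] := SD0 _ (SD' i).
  apply/submxP; exists (c - c0).
  by rewrite -(affine_mapB D0 a0) cE c0E addrK.
by move: D'u; rewrite D'E -mulmxA unitmx_mul => /andP[].
Qed.

End slope_limits.

(* The default value 0 is taken when [A] lies on no graph, that is, outside
   [Lambda @^-1` tilde W]; see [tilde_on_graph]. *)
Definition slope (R : realType) k m n (B' : 'M[R]_(n, k)) (C' : 'M[R]_(n, m))
    (A : ccvx R n k) : 'M[R]_(k, m) :=
  xget 0 [set M | exists y, on_graph B' C' M y A].

Definition intercept (R : realType) k m n (B' : 'M[R]_(n, k)) (C' : 'M[R]_(n, m))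
    (A : ccvx R n k) : 'rV[R]_m :=
  xget 0 [set y | on_graph B' C' (slope B' C' A) y A].

(** * [Lambda] and [tilde W] in coordinates *)

Section Lambda_frame.
Context {R : realType} {k m n : nat} {B : 'M[R]_(k, n)} {C : 'M[R]_(m, n)}.
Context {B' : 'M[R]_(n, k)} {C' : 'M[R]_(n, m)}.
Hypothesis BC : frame B C B' C'.
Implicit Types A V : ccvx R n k.

Lemma ccvx_affine_basis (A : ccvx R n k) :
  exists a (D : 'M[R]_(k, n)), affine_basis A a D.
Proof. exact: affine_basis_dim (ccvx_nonempty A) (ccvx_dim A). Qed.

Lemma on_graph_inj A M y M' y' :
  on_graph B' C' M y A -> on_graph B' C' M' y' A -> M = M' /\ y = y'.
Proof.
have [a [D AD]] := ccvx_affine_basis A.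
move=> /(on_graph_affine_basis BC AD)[_ -> ->].
by move=> /(on_graph_affine_basis BC AD)[_ -> ->].
Qed.

(** [D] is the invertible [D *m B'] times [B + M *m C], so both have the same row space; the
    intercept drops out on passing to the direction. *)
Lemma Lambda_on_graph A M y : on_graph B' C' M y A ->
  subspace_of (Lambda A) = graph_map B C M 0 @` setT.
Proof.
move=> MA; have [a [D AD]] := ccvx_affine_basis A; have [_ _ _ _ B'B] := BC.
rewrite LambdaE (direction_affine_basis AD).
have [Du _ _] := on_graph_affine_basis BC AD MA.
have [_ Aa DA _] := AD; have DE := on_graph_slope Aa DA MA.
have {}DE : D = D *m B' *m (B + M *m C).
  by rewrite mulmxDr (mulmxA (D *m B')) -DE -!mulmxA -mulmxDr B'B mulmx1.
apply/seteqP; split=> _ [c _ <-].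
  exists (c *m (D *m B')) => //.
  by rewrite /graph_map /affine_map mul0mx addr0 -mulmxA -DE.
exists (c *m invmx (D *m B')) => //=.
have DV : invmx (D *m B') *m D = B + M *m C by rewrite {2}DE mulKmx.
by rewrite /graph_map /affine_map mul0mx addr0 -mulmxA DV.
Qed.

Lemma on_graph_Lambda A M y : on_graph B' C' M y A ->
  on_graph B' C' M 0 (subspace_of (Lambda A)).
Proof. by move=> /Lambda_on_graph ->; exact: on_graph_image. Qed.

Lemma slopeP A : (exists M y, on_graph B' C' M y A) ->
  on_graph B' C' (slope B' C' A) (intercept B' C' A) A.
Proof.
move=> MA; have [y yA] : exists y, on_graph B' C' (slope B' C' A) y A.
  by rewrite /slope; case: xgetP => // none; case: MA => M My; have := none M.
by rewrite /intercept; case: xgetP => // none; have := none y.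
Qed.

Context (W : Grassmannian R n k).
Hypothesis WB : subspace_of W = range (mulmxr B : 'rV_k -> 'rV_n).
Hypothesis BO : (1%:M - B' *m B) *m B^T = 0.

Lemma oproj_frame x : oproj (subspace_of W) x = x *m B' *m B.
Proof.
have xO c : dotv (x - x *m B' *m B) (c *m B) = 0.
  have -> : x - x *m B' *m B = x *m (1%:M - B' *m B).
    by rewrite mulmxBr mulmx1 mulmxA.
  by rewrite dotvE trmx_mul mulmxA -(mulmxA x) BO mulmx0 mul0mx mxE.
rewrite /oproj; apply: xget_unique => /=; rewrite WB.
  by split=> [|_ [c _ <-]]; [exists (x *m B')|exact: xO].
move=> w [[c _ <-] wO].
(* A second candidate differs from the first by a vector of [W] orthogonal to [W], hence to
   itself. *)
have cO : dotv (c *m B - x *m B' *m B) (c *m B - x *m B' *m B) = 0.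
  rewrite -mulmxBl.
  have {1}-> : (c - x *m B') *m B = (x - x *m B' *m B) - (x - c *m B).
    by rewrite mulmxBl opprB [RHS]addrC addrA subrK.
  by rewrite dotvDl dotvNl xO wO ?subr0 //; exists (c - x *m B').
by apply/eqP; rewrite -subr_eq0 /= (dotv_eq0 cO).
Qed.

(** Projecting onto [W] keeps the [B]-coordinates. The direction maps onto [W] exactly when
    [D *m B'] is invertible for a basis [D] of it, which is the condition for lying on a graph. *)
Lemma tilde_on_graph A : tilde W (Lambda A) <-> exists M y, on_graph B' C' M y A.
Proof.
have [BB' _ _ _ B'B] := BC; rewrite /tilde /=.
have -> : oproj (subspace_of W) = fun x => x *m B' *m B.
  by apply/funext => x; exact: oproj_frame.
split=> [AW|[M [y MA]]].
  have [a [D AD]] := ccvx_affine_basis A; have [_ _ _ DA] := AD.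
  apply: (unit_on_graph DA); rewrite -row_full_unit -sub1mx.
  apply/row_subP => i; rewrite rowE mulmx1.
  have : subspace_of W (delta_mx 0 i *m B) by rewrite WB; exists (delta_mx 0 i).
  rewrite -AW LambdaE (direction_affine_basis AD) => -[_ [c _ <-] /= cE].
  apply/submxP; exists c; rewrite mulmxA -[LHS]mulmx1 -BB' mulmxA -cE.
  by rewrite -!mulmxA BB' mulmx1.
rewrite (Lambda_on_graph MA) WB; apply/seteqP; split.
  by move=> _ [_ [c _ <-] <-]; exists (graph_map B C M 0 c *m B').
move=> _ [c _ <-]; exists (graph_map B C M 0 c); first by exists c.
by have := graph_mapK BC M 0 c; rewrite {1}/affine_map addr0 => ->.
Qed.

Lemma tilde_self : tilde W W.
Proof.
have [BB' _ _ _ _] := BC; rewrite /tilde /= WB; apply/seteqP; split.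
  by move=> _ [_ [c _ <-] <-]; rewrite -WB oproj_frame WB; exists (c *m B *m B').
move=> _ [c _ <-]; exists (c *m B); first by exists c.
by rewrite -WB oproj_frame -(mulmxA c) BB' mulmx1.
Qed.

End Lambda_frame.

(** * Continuity of [Lambda] and the retraction property *)

Section retraction.
Context {R : realType} {k n : nat}.

Lemma Grassmannian_basis (V : Grassmannian R n k) :
  exists G : 'M[R]_(k, n), row_free G /\
    subspace_of V = range (mulmxr G : 'rV_k -> 'rV_n).
Proof. by apply/is_linearP; exact: set_mem (valP V). Qed.

Lemma Lambda_id (V : Grassmannian R n k) : Lambda (set_val V) = V.
Proof.
have [G [Gfree VG]] := Grassmannian_basis V.
apply: val_inj; apply: ccvx_inj; rewrite -[LHS]/(subspace_of _) LambdaE.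
rewrite (@direction_affine_basis _ _ _ _ 0 G) -?VG //; split => //.
- by rewrite -/(subspace_of V) VG; exists 0; rewrite //= mul0mx.
- move=> i; rewrite -/(subspace_of V) VG; exists (delta_mx 0 i) => //=.
  by rewrite addr0 rowE.
- by rewrite -/(subspace_of V) VG => _ [c _ <-]; exists c; rewrite // /affine_map addr0.
Qed.

Lemma adapted_frame (W : Grassmannian R n k) :
  exists (B : 'M[R]_(k, n)) (C : 'M[R]_(n - k, n)) B' C',
    [/\ frame B C B' C', subspace_of W = range (mulmxr B : 'rV_k -> 'rV_n) &
        (1%:M - B' *m B) *m B^T = 0].
Proof.
have [B [Bfree WB]] := Grassmannian_basis W.
have [C [B' [C' [BC BO]]]] := frame_exists Bfree.
by exists B, C, B', C'.
Qed.

Lemma Grassmannian_cvgP (T : Type) (F : set_system T) {FF : Filter F}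
    (f : T -> Grassmannian R n k) (V : Grassmannian R n k) :
  f @ F --> V <-> set_cvg F (fun t => subspace_of (f t)) (subspace_of V).
Proof.
rewrite -(ccvx_cvgP (fun t => set_val (f t)) (set_val V)); split=> fV.
  apply: cvg_comp fV _; exact: initial_continuous.
move=> P [Q [[Q' Q'o <-] Q'V] QP]; apply: filterS QP _; apply: fV.
exact: open_nbhs_nbhs.
Qed.

Lemma set_cvg_near_eq (T : Type) (F : set_system T) {FF : Filter F} p
    (S S' : T -> set 'rV[R]_p) A :
  (\forall t \near F, S t = S' t) -> set_cvg F S A -> set_cvg F S' A.
Proof. by move=> SS' SA r e e0; apply: filterS2 SS' (SA r e e0) => t ->. Qed.

Lemma set_cvg_cst (T : Type) (F : set_system T) {FF : Filter F} p (A : set 'rV[R]_p) :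
  set_cvg F (fun=> A) A.
Proof.
move=> r e e0; apply: nearW => t.
by split=> a Aa _; exists a; rewrite // subrr normr0 ltW.
Qed.

Lemma set_cvg_graph (T : Type) (F : set_system T) {FF : Filter F} m
    (B : 'M[R]_(k, n)) (C : 'M[R]_(m, n)) B' C' Mt yt
    (Kt : T -> set 'rV[R]_k) (M : 'M[R]_(k, m)) (y : 'rV[R]_m) K :
  frame B C B' C' -> Mt @ F --> M -> yt @ F --> y -> set_cvg F Kt K ->
  set_cvg F (fun t => graph_map B C (Mt t) (yt t) @` Kt t) (graph_map B C M y @` K).
Proof.
move=> BC MtM yty KtK.
apply: (@set_cvg_affine _ _ _ _ _ _ _ _ (fun=> B') (fun=> 0) _ _ _ B' 0) => //.
- by apply: cvgD; [exact: cvg_cst|apply: cvg_mulmx; [|exact: cvg_cst]].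
- by apply: cvg_mulmx; [|exact: cvg_cst].
- exact: cvg_cst.
- exact: cvg_cst.
- by move=> x _; exact: (graph_mapK BC).
- by apply: nearW => t x _; exact: (graph_mapK BC).
Qed.

Lemma near_tilde (W : Grassmannian R n k) (T : Type) (F : set_system T) {FF : Filter F}
    (f : T -> ccvx R n k) (A : ccvx R n k) :
  tilde W (Lambda A) -> f @ F --> A -> \forall t \near F, tilde W (Lambda (f t)).
Proof.
have [B [C [B' [C' [BC WB BO]]]]] := adapted_frame W.
move=> /(tilde_on_graph BC WB BO)[M [y MA]] /ccvx_cvgP fA.
have [a [D AD]] := ccvx_affine_basis A.
apply: filterS (near_on_graph BC AD MA fA (fun t => ccvx_affine_basis (f t))).
by move=> t ft; apply/(tilde_on_graph BC WB BO).
Qed.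

(** In a frame adapted to [Lambda A], every set near [A] lies on a graph whose slope tends to that
    of [A]. The directions are the full graphs with intercept 0, hence converge. *)
Lemma Lambda_continuous : continuous (@Lambda R n k).
Proof.
move=> A; have [B [C [B' [C' [BC WB BO]]]]] := adapted_frame (Lambda A).
have tildeP := tilde_on_graph BC WB BO.
have AW := tilde_self BC WB BO.
have /tildeP/slopeP MA := AW.
have [a [D AD]] := ccvx_affine_basis A.
have idA : id @ nbhs A --> A by exact: cvg_id.
have near_graph : \forall V \near A, on_graph B' C' (slope B' C' V)
    (intercept B' C' V) V.
  near=> V; apply: slopeP; apply/tildeP; near: V.
  exact: near_tilde AW idA.
suff : set_cvg (nbhs A) (fun V => subspace_of (Lambda V)) (subspace_of (Lambda A)).
  by move/Grassmannian_cvgP.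
rewrite (Lambda_on_graph BC MA).
have [slopeA _] := on_graph_cvg BC AD MA ((ccvx_cvgP id A).1 idA) near_graph.
have zeroA : (fun=> 0 : 'rV[R]_(n - k)) @ nbhs A --> (0 : 'rV[R]_(n - k)).
  exact: cvg_cst.
have graphA : set_cvg (nbhs A)
    (fun V => graph_map B C (slope B' C' V) 0 @` setT)
    (graph_map B C (slope B' C' A) 0 @` setT).
  by apply: (set_cvg_graph BC slopeA zeroA); exact: set_cvg_cst.
apply: set_cvg_near_eq graphA.
by near=> V; rewrite (Lambda_on_graph BC (near near_graph V _)).
Unshelve. all: by end_near. Qed.

End retraction.

(** * Local trivialization over [tilde W], for closed and compact sets at once *)

Section trivialization.
Context {R : realType} {k n : nat} (W : Grassmannian R n k).
Context {E K : topologicalType} (jE : E -> ccvx R n k) (jK : K -> ccvx R k k).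
Hypotheses (jE_inj : injective jE) (jK_inj : injective jK).
Hypothesis jE_cvg : forall T (F : set_system T) (FF : Filter F) (f : T -> E) e,
  f @ F --> e <-> jE \o f @ F --> jE e.
Hypothesis jK_cvg : forall T (F : set_system T) (FF : Filter F) (f : T -> K) e,
  f @ F --> e <-> jK \o f @ F --> jK e.
Hypothesis jE_image : forall K0 G b H c
  (GK : {in (jK K0 : set 'rV[R]_k), cancel (affine_map G b) (affine_map H c)}),
  exists e, jE e = affine_image GK.
Hypothesis jK_image : forall e G b H c
  (GK : {in (jE e : set 'rV[R]_n), cancel (affine_map G b) (affine_map H c)}),
  exists K0, jK K0 = affine_image GK.

Let P e := Lambda (jE e).

(** [E] and [K] are abstract so that one proof serves both classes: convergence is tested through
    [jE] and [jK], and affine images stay in the class. A triple [(V, (y, x))] goes to the part over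
    [x] of the graph with the slope of [V] and intercept [y]; the inverse reads off direction,
    intercept and projection. *)
Lemma trivialization : exists phi : tilde W * ('rV[R]_(n - k) * K) -> P @^-1` tilde W,
  homeomorphism phi /\ forall b t, P (set_val (phi (b, t))) = set_val b.
Proof.
have [B [C [B' [C' [BC WB BO]]]]] := adapted_frame W.
have tildeP := tilde_on_graph BC WB BO.
have slopeG (V : tilde W) :
    on_graph B' C' (slope B' C' (set_val (set_val V))) 0 (subspace_of (set_val V)).
  have /set_mem VW := valP V.
  have /tildeP/slopeP VG : tilde W (Lambda (set_val (set_val V))) by rewrite Lambda_id.
  by have := on_graph_Lambda BC VG; rewrite Lambda_id.
have LambdaG (A : ccvx R n k) y (V : tilde W) :
    on_graph B' C' (slope B' C' (set_val (set_val V))) y A -> Lambda A = set_val V.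
  move=> VA; apply: val_inj; apply: ccvx_inj.
  rewrite -[LHS]/(subspace_of (Lambda A)) (Lambda_on_graph BC VA).
  by rewrite -(Lambda_on_graph BC (slopeG V)) Lambda_id.
have /choice[phi phiE] : forall p : tilde W * ('rV[R]_(n - k) * K),
    exists e : P @^-1` tilde W, (jE (set_val e) : set 'rV[R]_n) =
      graph_map B C (slope B' C' (set_val (set_val p.1))) p.2.1 @` jK p.2.2.
  move=> [V [y x]] /=; set M := slope B' C' _.
  have MK : {in (jK x : set 'rV[R]_k),
      cancel (affine_map (B + M *m C) (y *m C)) (affine_map B' 0)}.
    by move=> z _; exact: (graph_mapK BC).
  have [e eE] := jE_image MK.
  have eW : (P @^-1` tilde W) e.
    rewrite /P /=; apply/tildeP; exists M, y; rewrite eE.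
    exact: (on_graph_image BC).
  by exists (exist _ e (mem_set eW)); rewrite /= eE.
have /choice[psi psiP] : forall e : P @^-1` tilde W,
    exists p : tilde W * ('rV[R]_(n - k) * K),
    [/\ set_val p.1 = P (set_val e),
        on_graph B' C' (slope B' C' (set_val (set_val p.1))) p.2.1 (jE (set_val e)) &
        (jK p.2.2 : set 'rV[R]_k) = affine_map B' 0 @` jE (set_val e)].
  move=> [e eW]; have PeW : tilde W (P e) := set_mem eW.
  have /tildeP/slopeP MA := PeW.
  set M := slope B' C' _ in MA; set y := intercept B' C' _ in MA.
  have [x xE] := jK_image (on_graphK BC MA).
  exists (exist _ (P e) (mem_set PeW), (y, x)); split => //=; last by rewrite xE.
  (* The slope found for [jE e] must be matched with the one computed from its direction; both are
     slopes of the direction, so uniqueness applies. *)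
  have [<- _] : M = slope B' C' (set_val (P e)) /\ (0 : 'rV[R]_(n - k)) = 0.
    apply: (on_graph_inj BC (A := set_val (P e))).
      exact: (on_graph_Lambda BC MA).
    exact: (slopeG (exist _ (P e) (mem_set PeW))).
  by [].
have Pphi p : P (set_val (phi p)) = set_val p.1.
  by apply: LambdaG; rewrite phiE; exact: (on_graph_image BC).
have phiK : cancel phi psi.
  move=> [V [y x]]; have [] := psiP (phi (V, (y, x))).
  case: (psi _) => V' [y' x'] /=; rewrite Pphi /= => /val_inj ->.
  rewrite phiE /= => Vy' x'E.
  have -> : x' = x.
    apply: jK_inj; apply: ccvx_inj; rewrite x'E image_comp.
    rewrite -[RHS]image_id; apply: eq_imagel => z _ /=.
    exact: (graph_mapK BC).
  suff [_ ->] : slope B' C' (set_val (set_val V)) = slope B' C' (set_val (set_val V)) /\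
    y' = y by [].
  apply: (on_graph_inj BC (A := jE (set_val (phi (V, (y, x)))))).
    by rewrite phiE.
  by rewrite phiE; exact: (on_graph_image BC).
have psiK : cancel psi phi.
  move=> e; have [eE eG xE] := psiP e.
  apply: val_inj; apply: jE_inj; apply: ccvx_inj.
  rewrite -[LHS]/(ccvx_set (jE (set_val (phi (psi e))))) phiE xE image_comp.
  rewrite -[RHS]image_id; apply: eq_imagel => z ez /=.
  by rewrite (on_graphK BC eG) // inE.
exists phi; split; last by move=> b t; rewrite Pphi.
exists psi; split => //.
(* Continuity of [phi]: the slope depends continuously on [V], by [on_graph_cvg] applied to the
   subspaces themselves with intercept 0. *)
- apply: continuous_comp_initial => p; apply/jE_cvg.
  suff : set_cvg (nbhs p) (fun t => jE (set_val (phi t)) : set 'rV[R]_n)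
      (jE (set_val (phi p))) by move/ccvx_cvgP.
  have -> : (fun t => jE (set_val (phi t)) : set 'rV[R]_n) =
      (fun t => graph_map B C (slope B' C' (set_val (set_val t.1))) t.2.1 @` jK t.2.2).
    by apply/funext => t; exact: phiE.
  rewrite phiE.
  have Vp : (fun t => set_val t.1) @ nbhs p --> set_val p.1.
    apply: (@continuous_comp _ _ _ fst set_val); first exact: cvg_fst.
    exact: initial_continuous.
  have [a [D AD]] := ccvx_affine_basis (set_val (set_val p.1)).
  have /Grassmannian_cvgP SV := Vp.
  have nearG : \forall t \near p, on_graph B' C'
      (slope B' C' (set_val (set_val t.1))) 0 (subspace_of (set_val t.1)).
    by near=> t; exact: slopeG.
  have [slopep _] := on_graph_cvg BC AD (slopeG p.1) SV nearG.
  apply: (set_cvg_graph BC slopep).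
    apply: (@continuous_comp _ _ _ snd fst); first exact: cvg_snd.
    exact: cvg_fst.
  suff : (fun t => jK t.2.2) @ nbhs p --> jK p.2.2 by move/ccvx_cvgP.
  apply/(jK_cvg _ (fun t => t.2.2)).
  apply: (@continuous_comp _ _ _ snd snd); first exact: cvg_snd.
  exact: cvg_snd.
- move=> e; have [eE eG xE] := psiP e.
  have ecvg (e0 : P @^-1` tilde W) : (fun e' => jE (set_val e')) @ nbhs e0 --> jE (set_val e0).
    by apply/(jE_cvg _ set_val); exact: initial_continuous.
  have /ccvx_cvgP Secvg := ecvg e.
  have [a [D AD]] := ccvx_affine_basis (jE (set_val e)).
  have nearG : \forall e' \near e, on_graph B' C'
      (slope B' C' (set_val (set_val (psi e').1))) (psi e').2.1 (jE (set_val e')).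
    by near=> e'; have [] := psiP e'.
  have [slopee ye] := on_graph_cvg BC AD eG Secvg nearG.
  (* [tilde W] has the topology induced from the Grassmannian, and there this component is [Lambda]
     of the given set. *)
  have Vcvg : (fun e' => (psi e').1) @ nbhs e --> (psi e).1.
    apply: (@continuous_comp_initial _ _ _ set_val (fun e' => (psi e').1)) => e0 /=.
    have -> : set_val \o (fun e' => (psi e').1) = P \o set_val.
      by apply/funext => e' /=; have [] := psiP e'.
    apply: (@continuous_comp _ _ _ (jE \o set_val) (@Lambda R n k)).
      exact: ecvg.
    exact: Lambda_continuous.
  have Kcvg : (fun e' => (psi e').2.2) @ nbhs e --> (psi e).2.2.
    apply/(jK_cvg _ (fun e' => (psi e').2.2)).
    suff : set_cvg (nbhs e) (fun e' => jK (psi e').2.2 : set 'rV[R]_k)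
        (jK (psi e).2.2) by move/ccvx_cvgP.
    have -> : (fun e' => jK (psi e').2.2 : set 'rV[R]_k) =
        (fun e' => affine_map B' 0 @` jE (set_val e')).
      by apply/funext => e'; have [] := psiP e'.
    rewrite xE.
    (* The projection is fixed; its inverse on the sets, the graph map, varies with [e']. *)
    apply: (@set_cvg_affine _ _ _ _ _ _ (fun=> B') (fun=> 0)
      (fun e' => B + slope B' C' (set_val (set_val (psi e').1)) *m C)
      (fun e' => (psi e').2.1 *m C) _ _ _
      (B + slope B' C' (set_val (set_val (psi e).1)) *m C) ((psi e).2.1 *m C)).
    + exact: cvg_cst.
    + exact: cvg_cst.
    + by apply: cvgD; [exact: cvg_cst|apply: cvg_mulmx; [|exact: cvg_cst]].
    + by apply: cvg_mulmx; [|exact: cvg_cst].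
    + exact: Secvg.
    + exact: (on_graphK BC eG).
    + by apply: nearW => e'; have [_ h _] := psiP e'; exact: (on_graphK BC h).
  have psiE e' : ((psi e').1, ((psi e').2.1, (psi e').2.2)) = psi e'.
    by rewrite -!surjective_pairing.
  suff : psi @ nbhs e --> psi e by [].
  rewrite -[X in _ --> X]psiE; apply: cvg_trans (cvg_pair Vcvg (cvg_pair ye Kcvg)).
  by apply: near_eq_cvg; near=> e'; exact: psiE.
Unshelve. all: by end_near. Qed.

End trivialization.

Lemma tilde_open (R : realType) (n k : nat) (W : Grassmannian R n k) : open (tilde W).
Proof.
rewrite openE => V VW; rewrite -(Lambda_id V) in VW.
have Vcvg : (fun V' : Grassmannian R n k => set_val V') @ nbhs V --> set_val V.
  exact: initial_continuous.
suff : \forall V' \near V, tilde W V' by [].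
near=> V'; rewrite -(Lambda_id V'); near: V'.
exact: near_tilde VW Vcvg.
Unshelve. all: by end_near. Qed.

Lemma mem_tilde (R : realType) (n k : nat) (W : Grassmannian R n k) : tilde W W.
Proof.
by have [B [C [B' [C' [BC WB BO]]]]] := adapted_frame W; exact: (tilde_self BC WB BO).
Qed.

(** * A compact convex set of full dimension *)

Section unit_ball.
Context {R : realType} (k : nat).

Let U := [set x : 'rV[R]_k | `|x| <= 1].

Let U0 : U 0. Proof. by rewrite /U /= normr0. Qed.

Let U_nonempty : U !=set0. Proof. by exists 0. Qed.

Let U_closed : closed U.
Proof.
apply: (@closed_comp _ _ (fun x : 'rV[R]_k => `|x|) [set x | x <= 1]).
  by move=> x _; exact: norm_continuous.
exact: closed_le.
Qed.

Let U_convex : convex_set (M := 'rV[R]_k) U.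
Proof.
apply/convex_setP => x y t; rewrite /U /= => x1 y1 t0 t1.
apply: (le_trans (ler_normD _ _)); rewrite !normrZ !ger0_norm ?subr_ge0 //.
have := ler_wpM2l t0 x1; have := ler_wpM2l (_ : 0 <= 1 - t) y1.
by rewrite subr_ge0 => /(_ t1); lra.
Qed.

Let U_dim : is_flat k (Aff U).
Proof.
apply: (@is_flat_affine_basis _ _ _ _ 0 1%:M); split.
- by rewrite row_free_unit unitmx1.
- exact: U0.
- move=> i; rewrite addr0 /U /= [leLHS]mx_normrE; apply: bigmax_le => // -[i' j] _ /=.
  by rewrite !mxE; case: eqP => _ /=; rewrite ?normr1 ?normr0.
- by move=> x _; exists x; rewrite // /affine_map mulmx1 addr0.
Qed.

Let U_bounded : bounded_set U.
Proof.
exists 1; split; first exact: num_real.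
by move=> N /ltW N1 x /= x1; exact: le_trans x1 N1.
Qed.

(** It provides a point of the fiber, for the surjectivity of the bundle projections. In the maximum
    norm it is a cube. *)
Definition unit_ball : bccvx R k k :=
  @Bccvx _ _ _ (Ccvx U_nonempty U_closed U_convex U_dim) U_bounded.

End unit_ball.

(** * From local trivializations to the fiber bundle *)

Section bundle.
Context {R : realType} {k n : nat}.
Context {E K : topologicalType} (jE : E -> ccvx R n k) (jK : K -> ccvx R k k).
Hypotheses (jE_inj : injective jE) (jK_inj : injective jK).
Hypothesis jE_cvg : forall T (F : set_system T) (FF : Filter F) (f : T -> E) e,
  f @ F --> e <-> jE \o f @ F --> jE e.
Hypothesis jK_cvg : forall T (F : set_system T) (FF : Filter F) (f : T -> K) e,
  f @ F --> e <-> jK \o f @ F --> jK e.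
Hypothesis jE_image : forall K0 G b H c
  (GK : {in (jK K0 : set 'rV[R]_k), cancel (affine_map G b) (affine_map H c)}),
  exists e, jE e = affine_image GK.
Hypothesis jK_image : forall e G b H c
  (GK : {in (jE e : set 'rV[R]_n), cancel (affine_map G b) (affine_map H c)}),
  exists K0, jK K0 = affine_image GK.

Let triv W := trivialization W jE_inj jK_inj jE_cvg jK_cvg jE_image jK_image.

(** This is the trivialization up to reassociating the product. *)
Lemma preimage_tilde_homeomorphic (W : Grassmannian R n k) :
  homeomorphic (set_type ((fun e => Lambda (jE e)) @^-1` tilde W))
    (set_type (tilde W) * 'rV[R]_(n - k) * K)%type.
Proof.
have [phi [[psi [phiK psiK phic psic]] _]] := triv W.
exists (fun e => ((psi e).1, (psi e).2.1, (psi e).2.2)).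
exists (fun p => phi (p.1.1, (p.1.2, p.2))); split.
- by move=> e /=; rewrite -!surjective_pairing psiK.
- by move=> [[V y] x] /=; rewrite phiK.
- move=> e.
  have c1 : (fun e' => (psi e').1) @ nbhs e --> (psi e).1.
    by apply: (@continuous_comp _ _ _ psi fst); [exact: psic|exact: cvg_fst].
  have c2 : (fun e' => (psi e').2.1) @ nbhs e --> (psi e).2.1.
    apply: (@continuous_comp _ _ _ psi (fst \o snd)); first exact: psic.
    by apply: (@continuous_comp _ _ _ snd fst); [exact: cvg_snd|exact: cvg_fst].
  have c3 : (fun e' => (psi e').2.2) @ nbhs e --> (psi e).2.2.
    apply: (@continuous_comp _ _ _ psi (snd \o snd)); first exact: psic.
    by apply: (@continuous_comp _ _ _ snd snd); [exact: cvg_snd|exact: cvg_snd].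
  exact: (cvg_pair (cvg_pair c1 c2) c3).
- move=> p; apply: (@continuous_comp _ _ _ (fun p => (p.1.1, (p.1.2, p.2))) phi).
    have c1 : (fun p => p.1.1) @ nbhs p --> p.1.1.
      apply: (@continuous_comp _ _ _ fst fst); first exact: cvg_fst.
      exact: cvg_fst.
    have c2 : (fun p => p.1.2) @ nbhs p --> p.1.2.
      apply: (@continuous_comp _ _ _ fst snd); first exact: cvg_fst.
      exact: cvg_snd.
    have c3 : (fun p => p.2) @ nbhs p --> p.2 by exact: cvg_snd.
    exact: (cvg_pair c1 (cvg_pair c2 c3)).
  exact: phic.
Qed.

(** The open sets [tilde W] cover because each [W] belongs to its own [tilde W]. The given point of
    [K] makes the fibers nonempty, whence surjectivity. *)
Lemma Lambda_fiber_bundle : K ->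
  fiber_bundle ('rV[R]_(n - k) * K)%type (fun e => Lambda (jE e)).
Proof.
move=> K0; split.
- move=> e; apply: (@continuous_comp _ _ _ jE (@Lambda R n k)).
    exact: ((jE_cvg _ id e).1 cvg_id).
  exact: Lambda_continuous.
- move=> V; have [phi [_ phiE]] := triv V.
  pose V' : tilde V := exist _ V (mem_set (mem_tilde V)).
  exists (set_val (phi (V', (0, K0)))).
  exact: phiE.
- exists (range (@tilde R n k)); first split.
  + by move=> _ [W _ <-]; exact: tilde_open.
  + by apply/seteqP; split => // V _; exists (tilde V); [exists V|exact: mem_tilde].
  + by move=> _ [W _ <-]; exact: triv.
Qed.

End bundle.

Theorem theorem5p4 (R : realType) (n k : nat) (hkn : (k <= n)%N) :
  [/\ retraction (@Lambda R n k),
      forall W : Grassmannian R n k,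
        homeomorphic (set_type (Lambda @^-1` tilde W))
          (set_type (tilde W) * 'rV[R]_(n - k) * ccvx R k k)%type,
      fiber_bundle ('rV[R]_(n - k) * ccvx R k k)%type (@Lambda R n k) &
      (forall W : Grassmannian R n k,
        homeomorphic (set_type (Gamma @^-1` tilde W))
          (set_type (tilde W) * 'rV[R]_(n - k) * bccvx R k k)%type) /\
      fiber_bundle ('rV[R]_(n - k) * bccvx R k k)%type (@Gamma R n k)].
Proof.
(* Closed sets use the abstract results with identity embeddings, compact sets with the inclusion
   [bccvx_ccvx]; the next four facts check the hypotheses. *)
have image_ccvx p q (A : ccvx R p k) G b H c
    (GK : {in (A : set 'rV[R]_p), cancel (affine_map G b) (affine_map H c)}) :
    exists e : ccvx R q k, id e = affine_image GK by exists (affine_image GK).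
have image_bccvx p q (A : bccvx R p k) G b H c
    (GK : {in (A : set 'rV[R]_p), cancel (affine_map G b) (affine_map H c)}) :
    exists e : bccvx R q k, (e : ccvx R q k) = affine_image GK.
  by exists (Bccvx (affine_image_bounded GK (@bccvx_bounded _ _ _ A))).
have cvg_ccvx p T (F : set_system T) (FF : Filter F) (f : T -> ccvx R p k)
    (A : ccvx R p k) :
  f @ F --> A <-> id \o f @ F --> id A by [].
have cvg_bccvx p T (F : set_system T) (FF : Filter F) (f : T -> bccvx R p k)
    (A : bccvx R p k) :
  f @ F --> A <-> @bccvx_ccvx R p k \o f @ F --> (A : ccvx R p k).
  exact: bccvx_cvgP.
split.
- by split; [exact: Lambda_continuous|exact: Lambda_id].
- exact: (@preimage_tilde_homeomorphic R k n (ccvx R n k) (ccvx R k k) id id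
    (fun _ _ => id) (fun _ _ => id) (@cvg_ccvx n) (@cvg_ccvx k)
    (@image_ccvx k n) (@image_ccvx n k)).
- exact: (@Lambda_fiber_bundle R k n (ccvx R n k) (ccvx R k k) id id
    (fun _ _ => id) (fun _ _ => id) (@cvg_ccvx n) (@cvg_ccvx k)
    (@image_ccvx k n) (@image_ccvx n k) (unit_ball k)).
split.
- exact: (@preimage_tilde_homeomorphic R k n (bccvx R n k) (bccvx R k k) _ _
    (@bccvx_inj R n k) (@bccvx_inj R k k)
    (@cvg_bccvx n) (@cvg_bccvx k) (@image_bccvx k n) (@image_bccvx n k)).
- exact: (@Lambda_fiber_bundle R k n (bccvx R n k) (bccvx R k k) _ _ (@bccvx_inj R n k) (@bccvx_inj R k k)
    (@cvg_bccvx n) (@cvg_bccvx k) (@image_bccvx k n) (@image_bccvx n k)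
    (unit_ball k)).
Qed.
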